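(* Let $n \ge 2$ and let $\Omega \subset \mathbb{R}^n$ be an unbounded domain. Let $r_* > 0$ be such that $S_r \cap \Omega \neq \emptyset$ for all $r > r_*$, where $S_r$ is the sphere of radius $r$ centered at the origin. Let $c : (0,\infty) \to (0,\infty)$ be a positive non-increasing function and let $\lambda > 3$ be such that $$\int_{r_*}^\infty r^\lambda c(r)\,dr = \infty.$$ Then every non-negative (viscosity) solution $u$ of the problem $$\Delta_\infty u \ge c(|x|)\, u^\lambda \ \text{in } \Omega, \qquad u|_{\partial\Omega} = 0$$ is identically zero.
   Context: The $\infty$-Laplacian is $\Delta_\infty u = \sum_{i,j=1}^n \frac{\partial^2 u}{\partial x_i \partial x_j}\frac{\partial u}{\partial x_i}\frac{\partial u}{\partial x_j}$. For $u:\Omega \to \mathbb{R}$ and $x \in \Omega$, the second-order superjet $J^{2,+}_\Omega u(x)$ is the set of pairs $(v,A)$ with $v \in \mathbb{R}^n$ and $A$ a symmetric $n\times n$ matrix such that $u(y) - u(x) \le \langle v, y-x\rangle + \frac12 \langle A(y-x), y-x\rangle + o(|y-x|^2)$ for all $y$ in some neighborhood of $x$. A function $u \ge 0$ on $\overline{\Omega}$ is a non-negative solution of the problem if $u$ is upper semicontinuous on $\overline{\Omega}$, $u = 0$ on $\partial\Omega$, and for every $x \in \Omega$ with $J^{2,+}_\Omega u(x) \ne \emptyset$ one has $\langle Av, v\rangle \ge c(|x|)u(x)^\lambda$ for all $(v,A) \in J^{2,+}_\Omega u(x)$. If $\Omega = \mathbb{R}^n$, the boundary condition is void. *)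

(* Defs.v *)
From HB Require Import structures.
From mathcomp Require Import all_boot all_order all_algebra.
From mathcomp Require Import all_classical all_reals all_analysis.
Set Implicit Arguments. Unset Strict Implicit. Unset Printing Implicit Defensive.
Import Order.TTheory GRing.Theory Num.Theory.
Import numFieldNormedType.Exports.
Local Open Scope classical_set_scope.
Local Open Scope ring_scope.

Definition dotv (R : realType) (n : nat) (x y : 'rV[R]_n) : R :=
  \sum_(i < n) x ord0 i * y ord0 i.
Definition enorm (R : realType) (n : nat) (x : 'rV[R]_n) : R :=
  Num.sqrt (dotv x x).

Definition qform (R : realType) (n : nat) (A : 'M[R]_n) (h : 'rV[R]_n) : R :=
  dotv (h *m A^T) h.

(* second-order superjet J^{2,+}_Omega u(x): the o(|y-x|^2) is written out *)
Definition superjet2 (R : realType) (n : nat) (Om : set 'rV[R]_n)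
  (u : 'rV[R]_n -> R) (x : 'rV[R]_n) (v : 'rV[R]_n) (A : 'M[R]_n) : Prop :=
  A^T = A /\
  forall eps : R, 0 < eps -> exists delta : R, 0 < delta /\
    forall y, Om y -> enorm (y - x) < delta ->
      u y - u x - dotv v (y - x) - 2^-1 * qform A (y - x)
        <= eps * enorm (y - x) ^+ 2.

Definition usc_on (R : realType) (n : nat) (D : set 'rV[R]_n)
  (u : 'rV[R]_n -> R) : Prop :=
  forall x, D x -> forall eps : R, 0 < eps -> exists delta : R, 0 < delta /\
    forall y, D y -> enorm (y - x) < delta -> u y < u x + eps.

Definition bdry (R : realType) (n : nat) (Om : set 'rV[R]_n) : set 'rV[R]_n :=
  closure Om `\` interior Om.

Definition nonneg_solution (R : realType) (n : nat) (Om : set 'rV[R]_n)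
  (c : R -> R) (lambda : R) (u : 'rV[R]_n -> R) : Prop :=
  [/\ (forall x, closure Om x -> 0 <= u x),
      usc_on (closure Om) u,
      (forall x, bdry Om x -> u x = 0) &
      forall x, Om x -> forall v A, superjet2 Om u x v A ->
        c (enorm x) * (u x `^ lambda) <= qform A v].

(* Main.v *)
(* Every test function is a quadratic polynomial [a + b |y - p| + k |y - p|^2] of
   the distance to a point [p], for which the infinity Laplacian is
   [2 k (b + 2 k |y - p|)^2].

   With [b = 0] on a ball, comparison shows that [u] doubles within a distance of
   order [u ^ ((3 - lambda) / 4)]; iterating, these distances form a geometric
   series, and boundedness of [u] on compact sets gives the Keller-Osserman bound
   [c r^4 u ^ (lambda - 3) <= const].

   Suppose [u p > 0].  Let [m_k] be the maximum of [u] on the ball of radius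
   [r_k = 2 ^ k r_0] around [p] and [s_k = (m_(k+1) - m_k) / r_k].  Comparison on
   the annulus [r_k <= |y - p| <= 4 r_k] shows that [s_k] increases, and, together
   with the Keller-Osserman bound, that
   [s_k ^ (3 - lambda) - s_(k+2) ^ (3 - lambda)] dominates a multiple of
   [c(16 r_k) r_k ^ (lambda + 1)].  The left-hand sides telescope, so the dyadic
   sums of [r ^ lambda c(r)], hence its integral, are finite. *)
Require Import Defs.
From HB Require Import structures.
From mathcomp Require Import all_boot all_order all_algebra.
From mathcomp Require Import all_classical all_reals all_analysis.
From mathcomp Require Import measurable_realfun.
From mathcomp Require Import ring lra.
Set Implicit Arguments. Unset Strict Implicit. Unset Printing Implicit Defensive.
Import Order.TTheory GRing.Theory Num.Theory.
Import numFieldNormedType.Exports.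
Local Open Scope classical_set_scope.
Local Open Scope ring_scope.

(** * Euclidean norm, its topology, and maxima of upper semicontinuous functions *)

Section EuclideanNorm.
Variables (R : realType) (n : nat).
Implicit Types x y z p : 'rV[R]_n.

Lemma dotvC x y : dotv x y = dotv y x.
Proof. by apply: eq_bigr => i _; rewrite mulrC. Qed.

Lemma dotvDl x y z : dotv (x + y) z = dotv x z + dotv y z.
Proof. by rewrite /dotv -big_split; apply: eq_bigr => i _; rewrite mxE mulrDl. Qed.

Lemma dotvZl (a : R) x y : dotv (a *: x) y = a * dotv x y.
Proof. by rewrite /dotv mulr_sumr; apply: eq_bigr => i _; rewrite mxE mulrA. Qed.

Lemma dotvDr x y z : dotv x (y + z) = dotv x y + dotv x z.
Proof. by rewrite dotvC dotvDl !(dotvC _ x). Qed.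

Lemma dotvZr (a : R) x y : dotv x (a *: y) = a * dotv x y.
Proof. by rewrite dotvC dotvZl dotvC. Qed.

Lemma dotvNl x y : dotv (- x) y = - dotv x y.
Proof. by rewrite -scaleN1r dotvZl mulN1r. Qed.

Lemma dotvNr x y : dotv x (- y) = - dotv x y.
Proof. by rewrite dotvC dotvNl dotvC. Qed.

Lemma dotv0l x : dotv 0 x = 0.
Proof. by rewrite -(scale0r x) dotvZl mul0r. Qed.

Definition dotvE := (dotvDl, dotvDr, dotvNl, dotvNr, dotvZl, dotvZr).

Lemma dotv_sqrD x y : dotv (x + y) (x + y) = dotv x x + 2 * dotv x y + dotv y y.
Proof. by rewrite !dotvE (dotvC y x); ring. Qed.

Lemma dotv_ge0 x : 0 <= dotv x x.
Proof. by apply: sumr_ge0 => i _; rewrite -expr2 sqr_ge0. Qed.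

Lemma enorm_ge0 x : 0 <= enorm x.
Proof. exact: sqrtr_ge0. Qed.

Lemma enorm_sq x : enorm x ^+ 2 = dotv x x.
Proof. by rewrite sqr_sqrtr ?dotv_ge0. Qed.

Lemma enorm0 : enorm (0 : 'rV[R]_n) = 0.
Proof. by rewrite /enorm dotv0l sqrtr0. Qed.

Lemma enorm_eq0 x : enorm x = 0 -> x = 0.
Proof.
move=> x0; have /eqP : dotv x x = 0 by rewrite -enorm_sq x0 expr0n.
rewrite psumr_eq0; last by move=> i _; rewrite -expr2 sqr_ge0.
move=> /allP xi0; apply/rowP => i; rewrite mxE.
have := xi0 i; rewrite mem_index_enum => /(_ isT) /=.
by rewrite mulf_eq0 orbb => /eqP.
Qed.

Lemma cauchy_schwarz x y : `|dotv x y| <= enorm x * enorm y.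
Proof.
rewrite -(@ler_pXn2r _ 2) ?nnegrE ?mulr_ge0 ?enorm_ge0 //.
rewrite real_normK ?num_real // exprMn !enorm_sq.
have [x0|x0] := eqVneq (dotv x x) 0.
  have -> : x = 0 by apply: enorm_eq0; rewrite /enorm x0 sqrtr0.
  by rewrite !dotv0l expr0n mul0r.
have e : dotv (dotv x x *: y - dotv x y *: x) (dotv x x *: y - dotv x y *: x) =
    dotv x x * (dotv x x * dotv y y - dotv x y ^+ 2).
  by rewrite !dotvE (dotvC y x); ring.
have := dotv_ge0 (dotv x x *: y - dotv x y *: x); rewrite e.
by rewrite pmulr_rge0 ?subr_ge0 // lt_def x0 dotv_ge0.
Qed.

Lemma dotv_le x y : dotv x y <= enorm x * enorm y.
Proof. exact: le_trans (ler_norm _) (cauchy_schwarz x y). Qed.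

Lemma ler_enormD x y : enorm (x + y) <= enorm x + enorm y.
Proof.
rewrite -(@ler_pXn2r _ 2) ?nnegrE ?addr_ge0 ?enorm_ge0 //.
rewrite enorm_sq dotv_sqrD sqrrD !enorm_sq.
have := dotv_le x y; lra.
Qed.

Lemma enormZ (a : R) x : enorm (a *: x) = `|a| * enorm x.
Proof.
by rewrite /enorm dotvZl dotvZr mulrA -expr2 sqrtrM ?sqr_ge0 // sqrtr_sqr.
Qed.

Lemma enormN x : enorm (- x) = enorm x.
Proof. by rewrite -scaleN1r enormZ normrN normr1 mul1r. Qed.

Lemma enorm_distC x y : enorm (x - y) = enorm (y - x).
Proof. by rewrite -enormN opprB. Qed.

Lemma ler_enorm_distD z x y : enorm (x - y) <= enorm (x - z) + enorm (z - y).
Proof. by have := ler_enormD (x - z) (z - y); rewrite subrKA. Qed.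

Lemma ler_dist_enorm x y : `|enorm x - enorm y| <= enorm (x - y).
Proof.
have h1 := ler_enormD (x - y) y; have h2 := ler_enormD (y - x) x.
rewrite !subrK in h1 h2; rewrite (enorm_distC y x) in h2.
by rewrite ler_norml; apply/andP; split; lra.
Qed.

Lemma coord_le_enorm x i : `|x ord0 i| <= enorm x.
Proof.
rewrite -(@ler_pXn2r _ 2) ?nnegrE ?enorm_ge0 // real_normK ?num_real //.
rewrite enorm_sq /dotv (bigD1 i) //= -expr2 lerDl.
by apply: sumr_ge0 => j _; rewrite -expr2 sqr_ge0.
Qed.

Lemma enorm_le_sum x : enorm x <= \sum_(i < n) `|x ord0 i|.
Proof.
have s0 : 0 <= \sum_(i < n) `|x ord0 i| by apply: sumr_ge0.
rewrite -(@ler_pXn2r _ 2) ?nnegrE ?enorm_ge0 // enorm_sq expr2 mulr_sumr.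
apply: ler_sum => i _; rewrite -expr2 -real_normK ?num_real // expr2.
apply: ler_wpM2r => //; rewrite (bigD1 i) //= lerDl.
by apply: sumr_ge0.
Qed.

(** The ambient balls on row vectors are entrywise; with [ball_of_enorm_lt], Euclidean balls define
    the same topology. Dividing by [n.+1] keeps the sum of [n] entries strictly below [d], even for
    [n = 0]. *)
Lemma enorm_lt_of_ball (d : R) : 0 < d -> exists e : R, 0 < e /\
  forall x y, ball x e y -> enorm (y - x) < d.
Proof.
move=> d0; exists (d / n.+1%:R); split; first by rewrite divr_gt0.
move=> x y [_ xy]; apply: le_lt_trans (enorm_le_sum _) _.
apply: (@le_lt_trans _ _ (\sum_(i < n) (d / n.+1%:R))).
  by apply: ler_sum => i _; rewrite !mxE distrC; apply/ltW/xy.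
rewrite sumr_const card_ord -[X in X < _]mulr_natr -mulrA gtr_pMr //.
by rewrite mulrC ltr_pdivrMr // mul1r ltr_nat.
Qed.

Lemma ball_of_enorm_lt (e : R) x y : 0 < e -> enorm (y - x) < e -> ball x e y.
Proof.
move=> e0 xy; split => // i j; rewrite (ord1 i).
apply: le_lt_trans xy; rewrite -opprB normrN.
by have := coord_le_enorm (y - x) j; rewrite !mxE.
Qed.

Lemma open_enormP (A : set 'rV[R]_n) x : open A -> A x ->
  exists d : R, 0 < d /\ forall y, enorm (y - x) < d -> A y.
Proof.
move=> oA Ax; have : nbhs x A by exact: open_nbhs_nbhs.
move=> /nbhs_ballP [e /= e0 eA]; exists e; split => // y xy.
exact/eA/ball_of_enorm_lt.
Qed.

Lemma closure_enorm_ex (A : set 'rV[R]_n) x : closure A x ->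
  forall d : R, 0 < d -> exists y, A y /\ enorm (y - x) < d.
Proof.
move=> cA d d0; have [e [e0 eE]] := enorm_lt_of_ball d0.
have [y [Ay yB]] := cA _ (nbhsx_ballx x e e0).
by exists y; split => //; apply: eE.
Qed.

Lemma closed_enorm_itv p (a b : R) : closed [set y | a <= enorm (y - p) <= b].
Proof.
move=> z /closure_enorm_ex h /=.
apply/andP; split; apply/ler_addgt0Pl => e e0; have [y [/= /andP[ay yb] yz]] := h e e0.
  by have := ler_enorm_distD z y p; lra.
by have := ler_enorm_distD y z p; rewrite (enorm_distC z y); lra.
Qed.

(** The superlevel sets of [f] at points of [K] are totally ordered, so they generate a filter.
    Compactness gives a cluster point, and upper semicontinuity makes it a maximizer. *)
Lemma usc_max (K : set 'rV[R]_n) (f : 'rV[R]_n -> R) p (r : R) :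
  closed K -> K !=set0 -> (forall y, K y -> enorm (y - p) <= r) ->
  usc_on K f -> exists z, K z /\ forall y, K y -> f y <= f z.
Proof.
move=> cK [y0 Ky0] Kr uK.
have coK : compact K.
  apply: (@subclosed_compact _ _ [set v : 'rV[R]_n | forall i,
    `[p ord0 i - r, p ord0 i + r]%classic (v ord0 i)]) => //.
    apply: (@rV_compact _ _ (fun i => `[p ord0 i - r, p ord0 i + r]%classic)).
    by move=> i; exact: segment_compact.
  move=> y /Kr yr i; have := le_trans (coord_le_enorm _ i) yr.
  by rewrite !mxE ler_distl /= in_itv.
pose F := filter_from K (fun x => [set y | K y /\ f x <= f y]).
have FF : ProperFilter F.
  apply: filter_from_proper; last by move=> x Kx; exists x; split.
  apply: filter_from_filter; first by exists y0.
  move=> a b Ka Kb; have [ab|/ltW ba] := leP (f a) (f b).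
    by exists b => // y [Ky yb]; split; split => //; apply: le_trans yb.
  by exists a => // y [Ky ya]; split; split => //; apply: le_trans ya.
have FK : F K by exists y0 => // y [].
have [z [Kz Fz]] := coK F FF FK.
exists z; split => // x Kx; apply/ler_addgt0Pl => e e0.
have [d [d0 dz]] := uK z Kz e e0.
have [e' [e'0 e'E]] := enorm_lt_of_ball d0.
have FB : F [set y | K y /\ f x <= f y] by exists x.
have [y [[Ky xy] zy]] := Fz _ _ FB (nbhsx_ballx z e' e'0).
by rewrite addrC; apply/ltW/(le_lt_trans xy)/dz => //; apply: e'E.
Qed.

End EuclideanNorm.

(** * Quadratic forms, superjets, and the differential inequality at the origin *)

Section Jets.
Variables (R : realType) (n : nat).
Implicit Types (x y z p v w h : 'rV[R]_n) (A B : 'M[R]_n) (Om : set 'rV[R]_n).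
Implicit Type u : 'rV[R]_n -> R.

Lemma qformD A B h : qform (A + B) h = qform A h + qform B h.
Proof. by rewrite /qform linearD /= mulmxDr dotvDl. Qed.

Lemma qformZ (a : R) A h : qform (a *: A) h = a * qform A h.
Proof. by rewrite /qform linearZ /= -scalemxAr dotvZl. Qed.

Lemma qform_scalar (a : R) h : qform a%:M h = a * dotv h h.
Proof. by rewrite /qform tr_scalar_mx mul_mx_scalar dotvZl. Qed.

Lemma qform_outer z h : qform (z^T *m z) h = dotv z h ^+ 2.
Proof.
rewrite /qform trmx_mul trmxK mulmxA.
have -> : h *m z^T = (dotv z h)%:M.
  apply/matrixP => i j; rewrite !ord1 !mxE eqxx mulr1n.
  by apply: eq_bigr => k _; rewrite !mxE mulrC.
by rewrite mul_scalar_mx dotvZl expr2.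
Qed.

Lemma dotv_mulmx_tr A x y : dotv (x *m A^T) y = dotv (y *m A) x.
Proof.
rewrite /dotv.
under eq_bigr do rewrite mxE mulr_suml.
under [RHS]eq_bigr do rewrite mxE mulr_suml.
rewrite exchange_big /=; apply: eq_bigr => i _; apply: eq_bigr => j _.
by rewrite !mxE; ring.
Qed.

Lemma qform_add A x h : A^T = A ->
  qform A (x + h) = qform A x + 2 * dotv (x *m A^T) h + qform A h.
Proof.
move=> sA.
have e : dotv (h *m A^T) x = dotv (x *m A^T) h by rewrite (dotv_mulmx_tr A h) sA.
by rewrite /qform mulmxDl !dotvE e; ring.
Qed.

Lemma enorm_mulmx_bound A : exists N : R, 0 < N /\
  forall x, enorm (x *m A^T) <= N * enorm x.
Proof.
pose N : R := \sum_(i < n) \sum_(j < n) `|A i j|.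
have N0 : 0 <= N by apply: sumr_ge0 => i _; apply: sumr_ge0.
exists (1 + N); split; first by lra.
move=> x; apply: le_trans (enorm_le_sum _) _.
apply: (@le_trans _ _ (N * enorm x)); last by rewrite mulrDl; have := enorm_ge0 x; lra.
rewrite /N mulr_suml; apply: ler_sum => i _.
rewrite mxE mulr_suml; apply: le_trans (ler_norm_sum _ _ _) _.
apply: ler_sum => j _; rewrite normrM mxE mulrC; apply: ler_wpM2l => //.
exact: coord_le_enorm.
Qed.

Lemma qform_bound A (N : R) : (forall x, enorm (x *m A^T) <= N * enorm x) ->
  forall x, `|qform A x| <= N * enorm x ^+ 2.
Proof.
move=> hN x; apply: le_trans (cauchy_schwarz _ _) _.
by rewrite expr2 mulrA; apply: ler_wpM2r (hN x); apply: enorm_ge0.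
Qed.

(** A cubic remainder is below [eps * |y - x|^2] once [|y - x| < eps / (C + 1)]; the [+ 1] admits
    [C = 0], the case of a quadratic touching from above. *)
Lemma superjet2_of_cubic Om u x v A (C d : R) : A^T = A -> 0 <= C -> 0 < d ->
  (forall y, Om y -> enorm (y - x) < d ->
    u y - u x - dotv v (y - x) - 2^-1 * qform A (y - x) <= C * enorm (y - x) ^+ 3) ->
  superjet2 Om u x v A.
Proof.
move=> sA C0 d0 hu; split => // e e0.
have C1 : 0 < C + 1 by lra.
exists (Num.min d (e / (C + 1))); split; first by rewrite lt_min d0 divr_gt0.
move=> y Oy; rewrite lt_min ltr_pdivlMr // => /andP[yd ye].
apply: le_trans (hu y Oy yd) _; rewrite exprSr mulrCA mulrC.
apply: ler_wpM2r; first by rewrite sqr_ge0.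
have := enorm_ge0 (y - x); lra.
Qed.

Lemma usc_onB (D K : set 'rV[R]_n) u (f : 'rV[R]_n -> R) : usc_on D u ->
  K `<=` D ->
  (forall x, exists L : R, forall y, enorm (y - x) < 1 ->
     - (L * enorm (y - x)) <= f y - f x) ->
  usc_on K (fun y => u y - f y).
Proof.
move=> uD KD hf x Kx e e0.
have e2 : 0 < e / 2 by lra.
have [d [d0 hd]] := uD x (KD _ Kx) _ e2.
have [L hL] := hf x; have L0 : 0 < 1 + `|L| by rewrite ltr_pwDl.
exists (Num.min d (Num.min 1 (e / 2 / (1 + `|L|)))).
split; first by rewrite !lt_min d0 ltr01 divr_gt0.
move=> y Ky; rewrite !lt_min => /and3P[yd y1]; rewrite ltr_pdivlMr // => ye.
have h1 := hd y (KD _ Ky) yd; have h2 := hL y y1.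
have h3 : L * enorm (y - x) <= enorm (y - x) * (1 + `|L|).
  rewrite mulrC; apply: ler_wpM2l; first exact: enorm_ge0.
  by have := ler_norm L; lra.
lra.
Qed.

Lemma exists_neq0_near v (t : R) : (0 < n)%N -> 0 < t ->
  exists v' : 'rV[R]_n, v' != 0 /\ enorm (v - v') <= t.
Proof.
move=> n0 t0; have [v0|v0] := eqVneq v 0; last first.
  by exists v; rewrite v0 subrr enorm0; split => //; exact: ltW.
pose e : 'rV[R]_n := delta_mx ord0 (Ordinal n0).
have e1 : enorm e = 1.
  rewrite /enorm /dotv (bigD1 (Ordinal n0)) //= big1.
    by rewrite !mxE !eqxx /= mulr1 addr0 sqrtr1.
  by move=> i /negPf ni; rewrite !mxE ni andbF mul0r.
exists (t *: e); split.
  apply/eqP => te0; have := enormZ t e.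
  by rewrite te0 enorm0 e1 mulr1 gtr0_norm // => t0'; move: t0; rewrite -t0' ltxx.
by rewrite v0 sub0r enormN enormZ e1 mulr1 gtr0_norm.
Qed.

Lemma powR_gt_approx (l a g : R) : 0 < l -> 0 < a -> g < a `^ l ->
  exists b : R, [/\ 0 < b, b < a & g < b `^ l].
Proof.
move=> l0 a0 ga; pose g' := Num.max g 0.
have al0 := powR_gt0 l a0.
have g'a : g' < a `^ l by rewrite gt_max ga.
have g'0 : 0 <= g' by rewrite le_max lexx orbT.
pose s := (g' + a `^ l) / 2; have s0 : 0 < s by rewrite /s; lra.
have sl : (s `^ l^-1) `^ l = s by rewrite -powRrM mulVf ?gt_eqF // powRr1 // ltW.
exists (s `^ l^-1); split; first exact: powR_gt0.
  rewrite ltNge; apply/negP => h.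
  have := @ge0_ler_powR _ l (ltW l0) a (s `^ l^-1).
  rewrite !nnegrE powR_ge0 (ltW a0) sl => /(_ isT isT h).
  by rewrite leNgt => /negP; apply; rewrite /s; lra.
rewrite sl; apply: (@le_lt_trans _ _ g'); first by rewrite le_max lexx.
by rewrite /s; lra.
Qed.

Lemma enorm_gt0 x : x != 0 -> 0 < enorm x.
Proof.
move=> x0; rewrite lt_neqAle enorm_ge0 andbT eq_sym.
by apply: contra_neq x0 => /enorm_eq0.
Qed.

Lemma exists_le4 (a b c d : R) : 0 < a -> 0 < b -> 0 < c -> 0 < d ->
  exists z : R, 0 < z /\ [/\ z <= a, z <= b, z <= c & z <= d].
Proof.
move=> a0 b0 c0 d0; exists (Num.min (Num.min a b) (Num.min c d)).
by rewrite !lt_min a0 b0 c0 d0; split => //; split; rewrite !ge_min lexx ?orbT.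
Qed.

(** Half of the cone pays for replacing [v] by a nearby nonzero [v']; the other half dominates all
    quadratic terms near the origin, whatever the size of [k]. Since [v'] is nonzero, [- k * |v'|^2]
    is unbounded below. *)
Lemma superjet2_cone Om u v (t r L : R) : (0 < n)%N -> 0 < t -> 0 < r -> 0 < L ->
  (forall y, Om y -> enorm y < r ->
    u y <= u 0 + dotv v y - t * enorm y + L * enorm y ^+ 2) ->
  forall m, exists v' A', superjet2 Om u 0 v' A' /\ qform A' v' < m.
Proof.
move=> n0 t0 r0 L0 hu m.
have t2 : 0 < t / 2 by lra.
have [v' [v'0 vv']] := exists_neq0_near v n0 t2.
have v'pos : 0 < enorm v' ^+ 2 by rewrite exprn_gt0 // enorm_gt0.
pose k := (`|m| + 1) / enorm v' ^+ 2.
have k0 : 0 < k by rewrite divr_gt0 // ltr_pwDr.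
have Lk : 0 < 2 * (L + k) by lra.
exists v', (- k)%:M; split; last first.
  rewrite qform_scalar -enorm_sq mulNr /k divfK ?gt_eqF //.
  by have := ler_norm (- m); rewrite normrN; lra.
apply: (@superjet2_of_cubic _ _ _ _ _ 0 (Num.min r (t / (2 * (L + k))))) => //.
- by rewrite tr_scalar_mx.
- by rewrite lt_min r0 divr_gt0.
move=> y Oy; rewrite subr0 mul0r lt_min ltr_pdivlMr // => /andP[yr yt].
have h1 := hu y Oy yr.
have h2 := dotv_le (v - v') y; rewrite dotvDl dotvNl in h2.
have h3 := ler_wpM2r (enorm_ge0 y) vv'.
have h4 := ler_wpM2r (enorm_ge0 y) (ltW yt).
have h5 := mulr_ge0 (ltW k0) (sqr_ge0 (enorm y)).
rewrite qform_scalar -enorm_sq.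
by clear -h1 h2 h3 h4 h5; rewrite !expr2 in h1 h5 *; lra.
Qed.

(** For every [q] of length at most [t], maximize [u] minus the quadratic of slope [v + q] over the
    closed ball. Either some maximizer is off the origin, or all sit at the origin and optimizing
    over [q] yields the cone. *)
Lemma tilted_max Om u v B (r t : R) : B^T = B -> 0 < r -> 0 < t ->
  usc_on (closure Om) u -> (forall y, enorm y <= r -> Om y) ->
  (forall y, enorm y = r -> u y + t * r < u 0 + dotv v y + 2^-1 * qform B y) ->
  (exists q y : 'rV[R]_n, [/\ enorm q <= t, y != 0, enorm y <= r,
     superjet2 Om u y (v + q + y *m B^T) B &
     u 0 + dotv (v + q) y + 2^-1 * qform B y <= u y]) \/
  (forall y, enorm y <= r ->
     u y <= u 0 + dotv v y + 2^-1 * qform B y - t * enorm y).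
Proof.
move=> sB r0 t0 uO rO hr.
pose K := [set y : 'rV[R]_n | 0 <= enorm (y - 0) <= r].
have KE y : K y <-> enorm y <= r by rewrite /K /= subr0 enorm_ge0.
have K0 : K 0 by apply/KE; rewrite enorm0 ltW.
pose psi (q y : 'rV[R]_n) := dotv (v + q) y + 2^-1 * qform B y.
have psiB q x y : psi q y - psi q x =
    dotv (v + q + x *m B^T) (y - x) + 2^-1 * qform B (y - x).
  rewrite /psi -{1 2}(subrKC x y) (qform_add x (y - x) sB) !dotvDl !dotvDr.
  by rewrite !dotvNr; lra.
have psi0 q : psi q 0 = 0 by rewrite /psi /qform mul0mx dotv0l dotvC dotv0l; lra.
have [N [N0 hN]] := enorm_mulmx_bound B.
have usc q : usc_on K (fun y => u y - psi q y).
  apply: usc_onB uO _ _; first by move=> y /KE/rO; apply: subset_closure.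
  move=> x; exists (enorm (v + q + x *m B^T) + N) => y y1; rewrite psiB.
  have := cauchy_schwarz (v + q + x *m B^T) (y - x).
  have := qform_bound hN (y - x); rewrite !ler_norml => /andP[h1 _] /andP[h2 _].
  have h3 := ler_wpM2r (mulr_ge0 (ltW N0) (enorm_ge0 (y - x))) (ltW y1).
  have h4 := mulr_ge0 (ltW N0) (enorm_ge0 (y - x)).
  by clear -h1 h2 h3 h4; rewrite expr2 in h1; lra.
have maxq q : exists z, K z /\ forall y, K y -> u y - psi q y <= u z - psi q z.
  apply: (@usc_max _ _ K _ 0 r) => //; first exact: closed_enorm_itv.
    by exists 0.
  by move=> y /andP[].
have [[q [y [qt y0 Ky ymax]]]|hno] := pselect (exists q y : 'rV[R]_n,
  [/\ enorm q <= t, y != 0, K y & forall y', K y' -> u y' - psi q y' <= u y - psi q y]).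
  left; exists q, y.
  have yr : enorm y <= r by apply/KE.
  have yu := ymax 0 K0; rewrite psi0 subr0 in yu.
  split => //; last by move: yu; rewrite /psi; lra.
  apply: (@superjet2_of_cubic _ _ _ _ _ 0 (r - enorm y)) => //.
    (* A tilt changes values on the sphere by at most [t * r], which the margin in [hr] absorbs; so
       the maximizer is interior. *)
    rewrite subr_gt0 lt_neqAle yr andbT; apply/eqP => yr'.
    have := hr y yr'; move: yu; rewrite /psi dotvDl.
    have := cauchy_schwarz q y; rewrite ler_norml => /andP[h1 _].
    have := ler_wpM2r (enorm_ge0 y) qt; rewrite {2}yr'.
    by clear -h1; lra.
  move=> y' Oy' yy'; rewrite mul0r.
  have : K y'.
    by apply/KE; have := ler_enormD (y' - y) y; rewrite subrK; lra.
  by move=> /ymax; have := psiB q y y'; clear; lra.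
right => y yr.
have hmax q : enorm q <= t -> u y - psi q y <= u 0.
  move=> qt; have [z [Kz zmax]] := maxq q.
  have [z0|z0] := eqVneq z 0.
    by have := zmax y; rewrite z0 psi0 subr0; apply; apply/KE.
  by exfalso; apply: hno; exists q, z.
have [y0|y0] := eqVneq y 0.
  by rewrite y0 enorm0 dotvC dotv0l /qform mul0mx dotv0l; lra.
have ypos := enorm_gt0 y0.
(* The tilt of length [t] opposite to [y] produces the term [- t * enorm y]. *)
have : enorm (- (t / enorm y) *: y) <= t.
  by rewrite enormZ normrN gtr0_norm ?divr_gt0 // divfK ?gt_eqF.
move=> /hmax; rewrite /psi dotvDl dotvZl -enorm_sq expr2 mulrA mulNr.
by rewrite divfK ?gt_eqF //; clear; lra.
Qed.

(* The differential inequality at the origin involves the unconstrained value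
   [c 0].  Tilt the test function by all small linear forms: either some tilted
   maximum lies off the origin, and the inequality there passes to the limit, or
   [u] lies below a downward cone at the origin, and then superjets with
   arbitrarily negative second-order part contradict the inequality. *)
Lemma superjet2_origin Om (c : R -> R) (l : R) u v A : (0 < n)%N -> open Om ->
  Om 0 -> usc_on (closure Om) u -> 0 < u 0 -> 0 < l ->
  (forall x, Om x -> forall v A, superjet2 Om u x v A ->
     c (enorm x) * (u x `^ l) <= qform A v) ->
  0 < c 1 -> (forall r, 0 < r -> r <= 1 -> c 1 <= c r) ->
  superjet2 Om u 0 v A -> c 1 * u 0 `^ l <= qform A v.
Proof.
move=> n0 oO O0 uO u0 l0 hu c1 hc [sA jA]; rewrite leNgt; apply/negP => hlt.
(* [h] will bound [u] from below at the tilted maximum; the violated inequality keeps a gap [g] with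
   [h] in place of [u 0]. *)
have [h [h0 hu0 hgap]] : exists b, [/\ 0 < b, b < u 0 & qform A v / c 1 < b `^ l].
  by apply: powR_gt_approx => //; rewrite ltr_pdivrMr // mulrC.
rewrite ltr_pdivrMr // mulrC in hgap.
have [g [g0 gE]] : exists g, 0 < g /\ c 1 * h `^ l = qform A v + g.
  by exists (c 1 * h `^ l - qform A v); rewrite subr_gt0; split => //; ring.
have [N0 [N00 hN0]] := enorm_mulmx_bound A.
have [V [V0 VE]] : exists V, 0 <= V /\ enorm v = V by exists (enorm v); rewrite enorm_ge0.
have V2 : 0 < 12 * (V ^+ 2 + 1) by have := sqr_ge0 V; lra.
have [e [e0 [e4 _ _ eV]]] := @exists_le4 4^-1 1 1 _ (ltac:(lra)) ltr01 ltr01 (divr_gt0 g0 V2).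
rewrite ler_pdivlMr // in eV.
(* The added [4 * e] leaves a margin [e * r ^+ 2] above [u] on the sphere of radius [r], more than
   the [t * r <= e * r ^+ 2 / 2] that the tilts consume. *)
pose B := A + (4 * e)%:M.
have sB : B^T = B by rewrite /B linearD /= sA tr_scalar_mx.
have qBE y : qform B y = qform A y + 4 * e * enorm y ^+ 2.
  by rewrite qformD qform_scalar enorm_sq.
have [N [N1 NE]] : exists N, 0 < N /\ N = N0 + 1 by exists (N0 + 1); lra.
have hN x : enorm (x *m B^T) <= N * enorm x.
  rewrite sB mulmxDr mul_mx_scalar; apply: le_trans (ler_enormD _ _) _.
  rewrite enormZ gtr0_norm; last by lra.
  have h1 := hN0 x; rewrite sA in h1.
  have h2 := ler_wpM2r (enorm_ge0 x) e4.
  by rewrite NE; clear -h1 h2; lra.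
have qB x := qform_bound hN x.
have {}qB x : - (N * enorm x ^+ 2) <= qform B x <= N * enorm x ^+ 2.
  by rewrite -ler_norml.
have M0 : 0 < 2 * (2 * N * V + N).
  by have := mulr_ge0 (ltW N1) V0; clear -N1; lra.
(* [z] bounds the gradient perturbation [q + y *m B^T]: it costs at most [g / 2] in the quadratic
   form, and the shift by [4 * e] at most [g / 3]. *)
have [z [z0 [z1 zM _ _]]] := @exists_le4 1 _ 1 1 ltr01 (divr_gt0 g0 M0) ltr01 ltr01.
rewrite ler_pdivlMr // in zM.
have [d [d0 hd]] := jA e e0.
have [d' [d'0 hd']] := open_enormP oO O0.
have W0 : 0 < 2 * (V + N + 1) by lra.
have uh : 0 < u 0 - h by lra.
have N2 : 0 < 2 * N by lra.
have [d1 [d10 [d1d d1d' d11 _]]] := @exists_le4 (d / 2) (d' / 2) 1 1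
  (ltac:(lra)) (ltac:(lra)) ltr01 ltr01.
have [r [r0 [rd1 rz ru _]]] := exists_le4 d10 (divr_gt0 z0 N2) (divr_gt0 uh W0) ltr01.
rewrite !ler_pdivlMr // in rz ru.
have [t [t0 [tz tr _ _]]] := @exists_le4 (z / 2) (e * r / 2) 1 1
  (ltac:(lra)) (divr_gt0 (mulr_gt0 e0 r0) (ltr0Sn _ 1)) ltr01 ltr01.
have rO y : enorm y <= r -> Om y.
  by move=> yr; apply: hd'; rewrite subr0; clear -yr rd1 d1d' r0; lra.
have rbd y : enorm y = r -> u y + t * r < u 0 + dotv v y + 2^-1 * qform B y.
  move=> yr; have := hd y (rO y _) _; rewrite subr0 yr lexx => /(_ isT).
  have -> : r < d by clear -rd1 d1d r0; lra.
  move=> /(_ isT); rewrite qBE yr.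
  have h1 := ler_wpM2r (ltW r0) tr; have h2 := mulr_gt0 (mulr_gt0 e0 r0) r0.
  by clear -h1 h2; rewrite expr2; lra.
have [[q [y [qt y0 yr jy uy]]]|hc1] := tilted_max sB r0 t0 uO rO rbd; last first.
  have [v' [A' [jet lt]]] := @superjet2_cone Om u v t r N n0 t0 r0 N1
    (fun y Oy yr => ltac:(idtac; have := hc1 y (ltW yr); have /andP[_] := qB y;
       have := mulr_ge0 (ltW N1) (sqr_ge0 (enorm y)); clear; lra))
    (c (enorm (0 : 'rV[R]_n)) * u 0 `^ l).
  by have := hu 0 O0 v' A' jet; rewrite leNgt lt.
have ypos := enorm_gt0 y0.
have := hu y (rO y yr) _ _ jy; apply/negP; rewrite -ltNge.
have zle : enorm (q + y *m B^T) <= z.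
  apply: le_trans (ler_enormD _ _) _; have h1 := hN y.
  have h2 := ler_wpM2l (ltW N1) yr.
  by clear -h1 h2 rz qt tz; lra.
have huy : h <= u y.
  apply: le_trans uy; rewrite dotvDl.
  have := cauchy_schwarz v y; rewrite ler_norml VE => /andP[h1 _].
  have := cauchy_schwarz q y; rewrite ler_norml => /andP[h2 _].
  have /andP[h3 _] := qB y.
  have y1 : enorm y <= 1 by clear -yr rd1 d11; lra.
  have q1 : enorm q <= 1 by clear -qt tz z1; lra.
  have h4 := ler_wpM2r (enorm_ge0 y) q1.
  have h5 := ler_wpM2r (mulr_ge0 (ltW N1) (enorm_ge0 y)) y1.
  have h6 := ler_wpM2r (ltW W0) yr.
  have h7 := mulr_ge0 (ltW W0) (enorm_ge0 y).
  have h8 := mulr_ge0 (ltW N1) (enorm_ge0 y).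
  by clear -h1 h2 h3 h4 h5 h6 h7 h8 ru hu0; rewrite expr2 in h3; lra.
have cy : c 1 * h `^ l <= c (enorm y) * u y `^ l.
  apply: ler_pM; rewrite ?(ltW c1) ?powR_ge0 //.
    by apply: hc => //; clear -yr rd1 d11; lra.
  by apply: ge0_ler_powR; rewrite ?nnegrE ?(ltW l0) ?(ltW h0) //;
    apply: le_trans (ltW h0) huy.
apply: lt_le_trans cy; rewrite -addrA gE qform_add // qBE VE.
set w := q + y *m B^T in zle *.
have h1 := dotv_le (v *m B^T) w; have h2 := hN v; rewrite VE in h2.
have h3 := ler_pM (enorm_ge0 _) (enorm_ge0 _) h2 zle.
have /andP[_ h4] := qB w.
have h5 := ler_wpM2r (mulr_ge0 (ltW N1) (enorm_ge0 w)) (le_trans zle z1).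
have h6 := ler_wpM2l (ltW N1) zle.
by clear -h1 h3 h4 h5 h6 zM eV g0 e0; rewrite !expr2 in h4 eV *; lra.
Qed.

End Jets.

(** * Radial test functions, comparison on balls, and the Keller-Osserman bound *)

(** Taylor expansion of the norm: [d] and [D] are the old and new lengths, [H] is the length of the
    increment and [t] its inner product with the old vector. For [X = D - d] and [Y = t / d] the
    left side equals [(Y ^+ 2 - X ^+ 2) / (2 * d)], while [|Y + X| <= 2 * H] and
    [|Y - X| <= H ^+ 2 / (2 * d)]. *)
Lemma norm_expansion (R : realType) (d D t H : R) :
  0 < d -> `|D - d| <= H -> `|t| <= d * H ->
  D ^+ 2 = d ^+ 2 + 2 * t + H ^+ 2 ->
  D - d - t / d - H ^+ 2 / (2 * d) + t ^+ 2 / (2 * d ^+ 3) <= H ^+ 3 / (2 * d ^+ 2).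
Proof.
move=> d0 XH tH eD; have d1 : d != 0 by rewrite gt_eqF.
have {tH} YH : `|t / d| <= H by rewrite normrM normfV (gtr0_norm d0) ler_pdivrMr // mulrC.
have H0 : 0 <= H := le_trans (normr_ge0 _) XH.
pose X := D - d; pose Y := t / d.
have eY : Y - X = (X ^+ 2 - H ^+ 2) / (2 * d).
  have -> : Y = (D ^+ 2 - d ^+ 2 - H ^+ 2) / (2 * d) by rewrite /Y eD; field.
  by rewrite /X; field.
have -> : D - d - t / d - H ^+ 2 / (2 * d) + t ^+ 2 / (2 * d ^+ 3) =
    (Y ^+ 2 - X ^+ 2) / (2 * d).
  rewrite (_ : X = Y - (Y - X)); last by ring.
  have -> : D - d = Y - (Y - X) by rewrite /X; ring.
  have eX : X ^+ 2 = H ^+ 2 + 2 * d * (Y - X) by rewrite eY; field.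
  have -> : (Y - (Y - X)) ^+ 2 = X ^+ 2 by ring.
  by rewrite eX /Y; field.
rewrite [leRHS](_ : _ = (H ^+ 3 / d) / (2 * d)); last by field.
apply: ler_wpM2r; first by rewrite invr_ge0; lra.
rewrite subr_sqr eY; apply: le_trans (ler_norm _) _.
rewrite normrM.
rewrite (_ : H ^+ 3 / d = (H ^+ 2 / (2 * d)) * (H + H)); last by field.
apply: ler_pM => //; last by apply: le_trans (ler_normD _ _) _; apply: lerD.
rewrite normrM normfV (gtr0_norm (_ : 0 < 2 * d)); last by lra.
apply: ler_wpM2r; first by rewrite invr_ge0; lra.
rewrite ler_norml; have := sqr_ge0 X.
have : X ^+ 2 <= H ^+ 2.
  by rewrite -(@real_normK _ X) ?num_real // ler_pXn2r ?nnegrE.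
by move=> h1 h2; clear -h1 h2; apply/andP; split; lra.
Qed.

(** Positivity and monotonicity of [c] are required on all of [R], so that they also cover the value
    at [0] which the inequality at the origin involves. *)
Record monotone_subsolution (R : realType) (n : nat) (Om : set 'rV[R]_n)
    (c : R -> R) (l : R) (u : 'rV[R]_n -> R) : Prop := {
  subsol_ge0 : forall x, closure Om x -> 0 <= u x;
  subsol_usc : usc_on (closure Om) u;
  subsol_bdry : forall x, bdry Om x -> u x = 0;
  subsol_jet : forall x, Om x -> forall v A, superjet2 Om u x v A ->
    c (enorm x) * (u x `^ l) <= qform A v;
  subsol_rhs_gt0 : forall r, 0 < c r;
  subsol_rhs_noninc : forall r s, r <= s -> c s <= c r;
  subsol_exponent_gt3 : 3 < l
}.

Section Comparison.
Variables (R : realType) (n : nat).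
Implicit Types (Om : set 'rV[R]_n) (c : R -> R) (u : 'rV[R]_n -> R).
Implicit Types (p x y z : 'rV[R]_n) (l : R).

(** The boundary condition enters the comparisons through this fact: a maximum point with positive
    value automatically lies in [Om]. *)
Lemma closure_gt0_Om Om c l u x : monotone_subsolution Om c l u ->
  closure Om x -> 0 < u x -> Om x.
Proof.
move=> sol cx ux; apply: contrapT => Ox; move: ux; rewrite (subsol_bdry sol) ?ltxx //.
by split => //; move=> /interior_subset.
Qed.

(** With [Z = z - p] of length [d], the test function has gradient [(2 * k + b / d) *: Z], and [Z]
    is an eigenvector of its Hessian with eigenvalue [2 * k]. For [b = 0] it is smooth at [p] too,
    hence the alternative in the hypotheses. *)
Lemma radial_jet Om c l u p z (b k d0 : R) : monotone_subsolution Om c l u ->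
  Om z -> 0 <= b -> (b = 0 \/ z != p) ->
  0 < d0 ->
  (forall y, Om y -> enorm (y - z) < d0 ->
    u y - (b * enorm (y - p) + k * enorm (y - p) ^+ 2) <=
    u z - (b * enorm (z - p) + k * enorm (z - p) ^+ 2)) ->
  c (enorm z) * u z `^ l <= 2 * k * (b + 2 * k * enorm (z - p)) ^+ 2.
Proof.
move=> sol Oz b0 bz d00 zmax; pose Z := z - p; pose d := enorm Z.
have sqD y : enorm (y - p) ^+ 2 =
    d ^+ 2 + 2 * dotv Z (y - z) + enorm (y - z) ^+ 2.
  rewrite /d !enorm_sq (_ : y - p = Z + (y - z)); last by rewrite [RHS]addrC /Z subrKA.
  by rewrite dotv_sqrD.
have [b00|bn0] := eqVneq b 0.
  have : superjet2 Om u z ((2 * k) *: Z) (2 * k)%:M.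
    apply: (@superjet2_of_cubic _ _ _ _ _ _ _ 0 d0) => //; first exact: tr_scalar_mx.
    move=> y Oy yz; have := zmax y Oy yz; rewrite b00 sqD.
    by rewrite qform_scalar dotvZl -enorm_sq -/Z -/d; clear; lra.
  move=> /(subsol_jet sol Oz); rewrite qform_scalar dotvZl dotvZr -enorm_sq -/d b00.
  by move=> h; apply: le_trans h _; rewrite le_eqVlt; apply/orP; left; apply/eqP; ring.
have zp : z != p by case: bz => // b00; rewrite b00 eqxx in bn0.
have d1 : 0 < d by apply: enorm_gt0; rewrite subr_eq0.
have dn0 : d != 0 by rewrite gt_eqF.
pose A : 'M[R]_n := (2 * k + b / d)%:M + (- (b / d ^+ 3)) *: (Z^T *m Z).
have : superjet2 Om u z ((2 * k + b / d) *: Z) A.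
  apply: (@superjet2_of_cubic _ _ _ _ _ _ _ (b / (2 * d ^+ 2)) d0) => //.
  - by rewrite /A linearD linearZ /= tr_scalar_mx trmx_mul trmxK.
  - by rewrite divr_ge0 // mulr_ge0 // sqr_ge0.
  move=> y Oy yz; have h1 := zmax y Oy yz; rewrite sqD -/Z -/d in h1.
  rewrite /A qformD qformZ qform_scalar qform_outer dotvZl -enorm_sq.
  have h2 : `|enorm (y - p) - d| <= enorm (y - z).
    apply: le_trans (ler_dist_enorm _ _) _.
    by rewrite /Z opprB addrA subrK.
  have /(ler_wpM2l b0) := @norm_expansion R d (enorm (y - p)) (dotv Z (y - z))
    (enorm (y - z)) d1 h2 (cauchy_schwarz _ _) (sqD y); move: h1.
  set D := enorm (y - p); set t := dotv Z (y - z); set H := enorm (y - z).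
  have -> : b * (D - d - t / d - H ^+ 2 / (2 * d) + t ^+ 2 / (2 * d ^+ 3)) =
    b * (D - d) - b / d * t - 2^-1 * (b / d) * H ^+ 2 + 2^-1 * (b / d ^+ 3) * t ^+ 2.
    by field.
  have -> : b * (H ^+ 3 / (2 * d ^+ 2)) = b / (2 * d ^+ 2) * H ^+ 3 by field.
  by clear; lra.
move=> /(subsol_jet sol Oz) h; apply: le_trans h _; rewrite le_eqVlt; apply/orP; left.
by rewrite /A qformD qformZ qform_scalar qform_outer dotvZl !dotvZr -enorm_sq -/d; apply/eqP; field.
Qed.

(** Common engine of the comparisons: compactness gives the maximizer, and [radial_jet] applies to
    it inside the annulus. With [a = -1] the annulus is a full ball whose centre counts as
    interior. *)
Lemma radial_max Om c l u p (a r b k : R) : monotone_subsolution Om c l u ->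
  0 <= b -> 0 <= k -> (b = 0 \/ 0 < a) ->
  (exists y, closure Om y /\ a <= enorm (y - p) <= r) ->
  exists z, [/\ closure Om z, a <= enorm (z - p) <= r,
   (forall y, closure Om y -> a <= enorm (y - p) <= r ->
    u y - (b * enorm (y - p) + k * enorm (y - p) ^+ 2) <=
    u z - (b * enorm (z - p) + k * enorm (z - p) ^+ 2)) &
   (a < enorm (z - p) < r -> 0 < u z ->
     c (enorm z) * u z `^ l <= 2 * k * (b + 2 * k * enorm (z - p)) ^+ 2)].
Proof.
move=> sol b0 k0 ba [y0 [cy0 y0r]].
pose K := closure Om `&` [set y | a <= enorm (y - p) <= r].
pose f y := b * enorm (y - p) + k * enorm (y - p) ^+ 2.
have clK : closed K.
  by apply: closedI; [exact: closed_closure|exact: closed_enorm_itv].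
have uK : usc_on K (fun y => u y - f y).
  apply: usc_onB (subsol_usc sol) _ _; first by move=> y [].
  move=> x; exists (b + k * (2 * enorm (x - p) + 1)) => y y1; rewrite /f.
  have hXY : `|enorm (y - p) - enorm (x - p)| <= enorm (y - x).
    by apply: le_trans (ler_dist_enorm _ _) _; rewrite opprB addrA subrK.
  move: y1 hXY (enorm_ge0 (y - p)) (enorm_ge0 (x - p)) (enorm_ge0 (y - x)).
  move: (enorm (y - p)) (enorm (x - p)) (enorm (y - x)) => D d H H1 hXY D0 d0 H0.
  move: hXY; rewrite ler_norml => /andP[h1 h2].
  have -> : b * D + k * D ^+ 2 - (b * d + k * d ^+ 2) = (b + k * (D + d)) * (D - d) by ring.
  have e0 : 0 <= b + k * (D + d) by rewrite addr_ge0 // mulr_ge0 // addr_ge0.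
  have g1 := ler_wpM2l e0 h1.
  have Dd : D + d <= 2 * d + 1 by lra.
  have g2 := ler_wpM2r H0 (ler_wpM2l k0 Dd).
  by clear -g1 g2; lra.
have [z [[cz zr] zmax]] : exists z, K z /\ forall y, K y -> u y - f y <= u z - f z.
  by apply: (@usc_max _ _ K _ p r) => //; [exists y0|move=> y [_ /andP[]]].
exists z; split => //; first by move=> y cy yr; exact: zmax.
move=> /andP[az zr'] uz0.
have Oz := closure_gt0_Om sol cz uz0.
apply: (@radial_jet Om c l u p z b k (Num.min (enorm (z - p) - a) (r - enorm (z - p)))) => //.
- case: ba => [->|a0]; [by left|right].
  apply/eqP => zp; move: az; rewrite zp subrr enorm0 => a0'.
  by have := lt_trans a0 a0'; rewrite ltxx.
- by rewrite lt_min !subr_gt0 az zr'.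
move=> y Oy; rewrite lt_min => /andP[y1 y2].
apply: zmax; split; first exact: subset_closure.
have h1 := ler_enorm_distD z y p; have h2 := ler_enorm_distD y z p.
rewrite (enorm_distC z y) in h2.
by apply/andP; split; lra.
Qed.

(** Let [z] maximize [u y - k * |y - p|^2] on the ball; then [u z >= h]. If [z] were interior, the
    jet inequality would bound [C * h ^ l] by [8 * k ^+ 3 * r ^+ 2]. So [z] is on the sphere, and
    comparison with the centre gives the growth. *)
Lemma quadratic_growth Om c l u p (h r C k : R) : monotone_subsolution Om c l u ->
  closure Om p -> 0 < h -> h <= u p ->
  0 < r -> 0 < k -> 0 < C -> (forall y, enorm (y - p) <= r -> C <= c (enorm y)) ->
  8 * k ^+ 3 * r ^+ 2 < C * h `^ l ->
  exists y, [/\ closure Om y, enorm (y - p) <= r & h + k * r ^+ 2 <= u y].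
Proof.
move=> sol cp h0 hu r0 k0 C0 hC hk.
have l3 := subsol_exponent_gt3 sol.
have [|z [cz /andP[_ zr] zmax zjet]] := @radial_max Om c l u p (-1) r 0 k sol (lexx _) (ltW k0) (or_introl erefl).
  by exists p; rewrite subrr enorm0; split => //; lra.
exists z; split => //.
have := zmax p cp; rewrite subrr enorm0 expr0n /= !mul0r !mulr0 !add0r subr0.
have -> : -1 <= (0 : R) <= r by lra.
move=> /(_ isT) zp.
have kz : 0 <= k * enorm (z - p) ^+ 2 by rewrite mulr_ge0 ?sqr_ge0 // ltW.
have uz : h <= u z by lra.
have [zlt|zge] := ltP (enorm (z - p)) r; last first.
  have -> : r = enorm (z - p) by apply: le_anti; rewrite zge zr.
  lra.
have : -1 < enorm (z - p) < r by rewrite zlt andbT; have := enorm_ge0 (z - p); lra.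
move=> /zjet /(_ (lt_le_trans h0 uz)); rewrite add0r => hz; exfalso.
have h1 : C * h `^ l <= c (enorm z) * u z `^ l.
  apply: ler_pM; rewrite ?(ltW C0) ?powR_ge0 //; first exact: hC.
  by apply: ge0_ler_powR; rewrite ?nnegrE; lra.
have h2 : enorm (z - p) ^+ 2 <= r ^+ 2 by rewrite ler_pXn2r ?nnegrE ?enorm_ge0 // ltW.
have k3 : 0 <= 8 * k ^+ 3 by rewrite mulr_ge0 // exprn_ge0 // ltW.
have h3 := ler_wpM2l k3 h2.
have e : 2 * k * (2 * k * enorm (z - p)) ^+ 2 = 8 * k ^+ 3 * enorm (z - p) ^+ 2 by ring.
by clear -hz h1 h3 e hk; lra.
Qed.

(** The ratio [q] with [2 ^ (l - 3) * q ^+ 4 = 1]: doubling [u] and shrinking the radius by [q]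
    preserves [C * u ^ (l - 3) * r ^+ 4]. *)
Definition doubling_ratio l : R := 2 `^ (- ((l - 3) / 4)).

Lemma doubling_ratio_gt0 l : 0 < doubling_ratio l.
Proof. exact: powR_gt0. Qed.

Lemma doubling_ratio_lt1 l : 3 < l -> doubling_ratio l < 1.
Proof.
move=> l3; rewrite /doubling_ratio /powR gt_eqF // expR_lt1 mulNr oppr_lt0.
by rewrite mulr_gt0 ?ln_gt0 ?ltr1n //; lra.
Qed.

(* [u] doubles within a distance proportional to [u ^ ((3 - l) / 4)]; were the
   estimate false these distances would sum to at most [r], and [u] would be
   unbounded on a compact ball. *)
Lemma keller_osserman Om c l u p (r C : R) : monotone_subsolution Om c l u ->
  closure Om p -> 0 < u p -> 0 < r -> 0 < C ->
  (forall y, enorm (y - p) <= r -> C <= c (enorm y)) ->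
  C * u p `^ (l - 3) * ((1 - doubling_ratio l) * r) ^+ 4 <= 8.
Proof.
move=> sol cp up r0 C0 hC; rewrite leNgt; apply/negP => hlt.
have l3 := subsol_exponent_gt3 sol; have q0 := doubling_ratio_gt0 l; have q1 := doubling_ratio_lt1 l3.
set q := doubling_ratio l in q0 q1 hlt *.
have q4 j : (2 ^+ j) `^ (l - 3) * (q ^+ j) ^+ 4 = 1.
  have -> : (q ^+ j) ^+ 4 = (2 ^+ j) `^ (- (l - 3)).
    have q4 : q ^+ 4 = 2 `^ (- (l - 3)).
      rewrite -(@powR_mulrn _ q 4) ?(ltW q0) // /q /doubling_ratio -powRrM.
      by congr (_ `^ _); field.
    by rewrite exprAC q4 -(@powR_mulrn _ (2 `^ _) j) ?powR_ge0 // powRAC powR_mulrn.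
  by rewrite powRN mulfV // gt_eqF // powR_gt0 // exprn_gt0.
(* Steps of length [(1 - q) * r * q ^+ j] have partial sums [r * (1 - q ^+ j)]. *)
have seq j : exists y, [/\ closure Om y, enorm (y - p) <= r * (1 - q ^+ j)
    & 2 ^+ j * u p <= u y].
  elim: j => [|j [y [cy yp uy]]].
    by exists p; rewrite subrr enorm0 !expr0 mul1r subrr mulr0.
  have qj0 : 0 < q ^+ j by rewrite exprn_gt0.
  have hj0 : 0 < 2 ^+ j * u p by rewrite mulr_gt0 // exprn_gt0.
  have rj0 : 0 < (1 - q) * r * q ^+ j by rewrite !mulr_gt0 // subr_gt0.
  pose hj := 2 ^+ j * u p; pose rj := (1 - q) * r * q ^+ j.
  (* With coefficient [hj / rj ^+ 2], quadratic growth adds exactly [hj]; by scale invariance its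
     smallness condition is the negated claim. *)
  have kj0 : 0 < hj / rj ^+ 2 by rewrite divr_gt0 // exprn_gt0.
  have hCj y' : enorm (y' - y) <= rj -> C <= c (enorm y').
    move=> yy'; apply: hC; have h1 := ler_enorm_distD y y' p.
    have h2 : 0 < r * (q ^+ j * q) by rewrite !mulr_gt0.
    by clear -h1 h2 yy' yp; rewrite /rj in yy'; lra.
  have [|y' [cy' yy' uy']] := @quadratic_growth Om c l u y hj rj C (hj / rj ^+ 2) sol cy hj0 uy rj0 kj0 C0 hCj.
    rewrite (_ : 8 * _ * _ = 8 * hj ^+ 3 / rj ^+ 4); last first.
      by field; rewrite gt_eqF.
    rewrite ltr_pdivrMr ?exprn_gt0 //.
    have -> : hj `^ l = hj ^+ 3 * (2 ^+ j) `^ (l - 3) * u p `^ (l - 3).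
      rewrite -mulrA -powRM ?exprn_ge0 ?(ltW up) // -/hj -powR_mulrn ?(ltW hj0) //.
      by rewrite -powRD ?(gt_eqF hj0) ?implybT //; congr (_ `^ _); ring.
    have -> : C * (hj ^+ 3 * (2 ^+ j) `^ (l - 3) * u p `^ (l - 3)) * rj ^+ 4 =
      hj ^+ 3 * (C * u p `^ (l - 3) * ((1 - q) * r) ^+ 4) *
      ((2 ^+ j) `^ (l - 3) * (q ^+ j) ^+ 4) by rewrite /rj; ring.
    rewrite q4 mulr1 mulrC ltr_pM2l //; exact: exprn_gt0.
  exists y'; split => //.
    have h1 := ler_enorm_distD y y' p; rewrite exprSr.
    by clear -h1 yy' yp; rewrite /rj in yy'; lra.
  move: uy'; rewrite divfK; last by rewrite gt_eqF // exprn_gt0.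
  by rewrite exprSr /hj; clear; lra.
have [|z [cz _ zmax _]] := @radial_max Om c l u p (-1) r 0 0 sol (lexx _) (lexx _) (or_introl erefl).
  by exists p; rewrite subrr enorm0; split => //; lra.
pose N := Num.bound (u z / u p).
have [y [cy yp uy]] := seq N.
have := zmax y cy; rewrite !mul0r !addr0 !subr0.
have -> : -1 <= enorm (y - p) <= r.
  have h1 := enorm_ge0 (y - p).
  have h2 : 0 < r * q ^+ N by rewrite mulr_gt0 // exprn_gt0.
  by apply/andP; split; lra.
move=> /(_ isT) uyz.
have : u z / u p < 2 ^+ N.
  apply: lt_le_trans (_ : N%:R <= _); last by rewrite -natrX ler_nat ltnW // ltn_expl.
  by apply: archi_boundP; rewrite divr_ge0 ?(subsol_ge0 sol) ?(ltW up).
rewrite ltr_pdivrMr //; lra.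
Qed.

End Comparison.

(** * Real-variable inequalities for powers *)

(** Use [exp t >= 1 + t] with [t = E * ln (1 + d)]; the bound [ln (1 + d) >= d / 2] comes from
    [ln s <= s - 1] at [s = (1 + d)^-1]. *)
Lemma powR_1D_ge (R : realType) (E d : R) : 0 < E -> 0 <= d -> d <= 1 ->
  1 + E * d / 2 <= (1 + d) `^ E.
Proof.
move=> E0 d0 d1; have D0 : 0 < 1 + d by lra.
rewrite /powR gt_eqF //; apply: le_trans (expR_ge1Dx _).
rewrite lerD2l -mulrA; apply: ler_wpM2l; first exact: ltW.
have h : ln (1 + d)^-1 <= (1 + d)^-1 - 1.
  rewrite -{1}(subrKC 1 (1 + d)^-1); apply: le_ln1Dx.
  by have := invr_gt0 (1 + d); rewrite D0; lra.
rewrite lnV ?posrE // in h.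
have : (1 + d)^-1 <= 1 - d / 2 by rewrite -div1r ler_pdivrMr //; nra.
by lra.
Qed.

(** Discrete counterpart of integrating [s' >= a * w * s ^ (E + 1)], under which [s ^ (- E)] falls
    at rate [E * a * w]. If a ratio exceeds [2], the fall is at least a fixed fraction of
    [s1 ^ (- E) >= w / K]; otherwise [powR_1D_ge] applies, [a * K <= 1] keeping the relative
    increment at most [1]. *)
Lemma powRN_drop (R : realType) (E K a w s0 s1 s2 : R) : 0 < E -> 0 < K -> 0 < a ->
  a * K <= 1 -> 0 < w -> 0 < s0 -> s0 <= s1 -> s1 <= s2 -> w * s1 `^ E <= K ->
  (s1 <= 2 * s0 -> s2 <= 2 * s1 -> s1 * (1 + a * (w * s1 `^ E)) <= s2) ->
  Num.min ((1 - 2 `^ (- E)) / K) (2 `^ (- E) * (E * a / 2)) * w <=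
    s0 `^ (- E) - s2 `^ (- E).
Proof.
move=> E0 K0 a0 aK w0 s00 s01 s12 wK hreg.
have s10 := lt_le_trans s00 s01; have s20 := lt_le_trans s10 s12.
have anti x y : 0 < x -> x <= y -> y `^ (- E) <= x `^ (- E).
  move=> x0 xy; have y0 := lt_le_trans x0 xy.
  rewrite !powRN lef_pV2 ?posrE ?powR_gt0 //.
  by apply: ge0_ler_powR; rewrite ?nnegrE ?(ltW E0) ?(ltW x0) ?(ltW y0).
have T1 : s1 `^ (- E) * s1 `^ E = 1 by rewrite powRN mulVf // gt_eqF // powR_gt0.
have T1p : 0 < s1 `^ (- E) := powR_gt0 _ s10.
have h2 : 0 < 2 `^ (- E) :> R by exact: powR_gt0.
have h21 : 2 `^ (- E) < 1 :> R.
  by rewrite /powR gt_eqF // expR_lt1 mulNr oppr_lt0 mulr_gt0 ?ln_gt0 ?ltr1n.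
have wT : w / K <= s1 `^ (- E).
  rewrite ler_pdivrMr //.
  have := ler_wpM2l (ltW T1p) wK.
  by rewrite mulrCA T1 mulr1.
have jump x y : 0 < x -> 2 * x <= y -> y `^ (- E) <= 2 `^ (- E) * x `^ (- E).
  by move=> x0 xy; rewrite -powRM ?(ltW x0) //; apply: anti => //; rewrite mulr_gt0.
have T01 := anti _ _ s00 s01; have T12 := anti _ _ s10 s12.
have big : (1 - 2 `^ (- E)) * s1 `^ (- E) <= s0 `^ (- E) - s2 `^ (- E) ->
    Num.min ((1 - 2 `^ (- E)) / K) (2 `^ (- E) * (E * a / 2)) * w <=
    s0 `^ (- E) - s2 `^ (- E).
  move=> h; apply: le_trans h.
  apply: (@le_trans _ _ ((1 - 2 `^ (- E)) / K * w)).
    by rewrite ler_pM2r // ge_min lexx.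
  by rewrite -mulrA (mulrC _ w); apply: ler_wpM2l => //; lra.
have [s1s0|s1s0] := leP s1 (2 * s0); last first.
  have := jump _ _ s00 (ltW s1s0) => h; apply: big.
  have := ler_wpM2l (_ : 0 <= 1 - 2 `^ (- E)) T01.
  by clear -h T12 h21; lra.
have [s2s1|s2s1] := leP s2 (2 * s1); last first.
  have := jump _ _ s10 (ltW s2s1) => h; apply: big.
  by clear -h T01; lra.
have {hreg} := hreg s1s0 s2s1.
set d := a * (w * s1 `^ E) => hs2.
have d0 : 0 < d by rewrite !mulr_gt0 // powR_gt0.
have d1 : d <= 1 by apply: le_trans aK; rewrite ler_pM2l.
have hd := powR_1D_ge E0 (ltW d0) d1.
have T2 : s2 `^ (- E) * (1 + d) `^ E <= s1 `^ (- E).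
  have D0 : 0 < 1 + d by rewrite addr_gt0.
  have dE : 0 < (1 + d) `^ E by exact: powR_gt0.
  have := anti _ _ (mulr_gt0 s10 D0) hs2; rewrite powRM ?(ltW s10) ?(ltW D0) //.
  rewrite -(@ler_pM2r _ ((1 + d) `^ E)) // -mulrA (powRN (1 + d)) mulVf ?mulr1 //.
  by rewrite gt_eqF.
(* As [s2 <= 2 * s1], the factor [s2 ^ (- E)] is traded for a multiple of [s1 ^ (- E)], which
   cancels the power of [s1] in [d]. *)
have T2' : 2 `^ (- E) * s1 `^ (- E) <= s2 `^ (- E).
  by rewrite -powRM ?(ltW s10) //; apply: anti.
apply: (@le_trans _ _ (2 `^ (- E) * (E * a / 2) * w)).
  by rewrite ler_pM2r // ge_min lexx orbT.
have -> : 2 `^ (- E) * (E * a / 2) * w = 2 `^ (- E) * s1 `^ (- E) * (E * d / 2).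
  rewrite /d (_ : _ * _ * (E * _ / 2) = 2 `^ (- E) * (E * a / 2) * w * (s1 `^ (- E) * s1 `^ E)).
    by rewrite T1 mulr1.
  by ring.
have Ed : 0 <= E * d / 2 by rewrite divr_ge0 // mulr_ge0 // ltW.
have h3 := ler_wpM2r Ed T2'.
have h4 := ler_wpM2l (ltW (powR_gt0 (- E) s20)) hd.
by clear -h3 h4 T2 T01; lra.
Qed.

(** * Maxima over concentric balls and growth of their dyadic slopes *)

Section BallMaximum.
Variables (R : realType) (n : nat).
Implicit Types (Om : set 'rV[R]_n) (c : R -> R) (u : 'rV[R]_n -> R).
Implicit Types (p x y z : 'rV[R]_n) (l : R).

Definition ball_max Om u p (r m : R) : Prop :=
  (forall y, closure Om y -> enorm (y - p) <= r -> u y <= m) /\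
  (exists z, [/\ closure Om z, enorm (z - p) <= r & u z = m]).

Lemma ball_max_ex Om c l u p (r : R) : monotone_subsolution Om c l u ->
  closure Om p -> 0 <= r -> exists m, ball_max Om u p r m.
Proof.
move=> sol cp r0.
have e1 y : (-1 <= enorm (y - p) <= r) = (enorm (y - p) <= r).
  by have -> : -1 <= enorm (y - p) by have := enorm_ge0 (y - p); lra.
have [|z [cz zr zmax _]] := @radial_max _ _ Om c l u p (-1) r 0 0 sol (lexx _) (lexx _) (or_introl erefl).
  by exists p; rewrite e1 subrr enorm0.
exists (u z); split; last by exists z; rewrite -e1.
by move=> y cy; rewrite -e1 => yr; have := zmax y cy yr; rewrite !mul0r !addr0 !subr0.
Qed.

Lemma ball_max_le Om u p (r s m m' : R) : r <= s -> ball_max Om u p r m ->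
  ball_max Om u p s m' -> m <= m'.
Proof.
move=> rs [_ [z [cz zr <-]]] [h _]; apply: h => //; exact: le_trans rs.
Qed.

(** Apply [quadratic_growth] at a maximizer for the smaller ball; taking [k <= 1] gives
    [k ^+ 3 <= k], so a linear smallness condition on [k] suffices. *)
Lemma ball_max_lt Om c l u p (r C m m' : R) : monotone_subsolution Om c l u ->
  0 < r -> 0 < C -> (forall y, enorm (y - p) <= 2 * r -> C <= c (enorm y)) ->
  0 < m -> ball_max Om u p r m -> ball_max Om u p (2 * r) m' -> m < m'.
Proof.
move=> sol r0 C0 hC m0 [_ [z [cz zr uz]]] [hm' _].
have g0 : 0 < C * m `^ l by rewrite mulr_gt0 // powR_gt0.
have g1 : 0 < C * m `^ l / (16 * r ^+ 2).
  by rewrite divr_gt0 // mulr_gt0 // exprn_gt0.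
have [k [k0 [k1 kg _ _]]] := exists_le4 ltr01 g1 ltr01 ltr01.
rewrite ler_pdivlMr in kg; last by rewrite mulr_gt0 // exprn_gt0.
have k3 : k ^+ 3 <= k.
  by rewrite -[leRHS]mulr1 exprS ler_pM2l // exprn_ile1 // ltW.
have hk : 8 * k ^+ 3 * r ^+ 2 < C * m `^ l.
  have h1 := ler_wpM2r (sqr_ge0 r) k3.
  by clear -h1 kg g0; lra.
have hCz y : enorm (y - z) <= r -> C <= c (enorm y).
  by move=> yz; apply: hC; have := ler_enorm_distD z y p; clear -yz zr; lra.
have mz : m <= u z by rewrite uz.
have [y [cy yz uy]] := quadratic_growth sol cz m0 mz r0 k0 C0 hCz hk.
apply: lt_le_trans (hm' y cy _); last first.
  by have := ler_enorm_distD z y p; clear -yz zr; lra.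
by apply: lt_le_trans uy; rewrite ltrDl mulr_gt0 // exprn_gt0.
Qed.

(** [s] is the mean slope of the maxima over [[r, 4 * r]]. With [b = s - 5 * k * r] the profile
    [b * D + k * D ^+ 2] rises by exactly [m4 - m1] there, and by [s * r - 2 * k * r ^+ 2] from [r]
    to [2 * r]. Its derivative stays below [2 * s], so the last hypothesis forbids an interior
    maximum with [u > m1]. *)
Lemma annulus_comparison Om c l u p (r C m1 m2 m4 s k : R) :
  monotone_subsolution Om c l u -> 0 < r -> 0 < C ->
  (forall y, enorm (y - p) <= 4 * r -> C <= c (enorm y)) -> 0 < m1 ->
  ball_max Om u p r m1 -> ball_max Om u p (2 * r) m2 ->
  ball_max Om u p (4 * r) m4 -> m4 = m1 + 3 * s * r ->
  0 < k -> 5 * k * r <= s -> 8 * k * s ^+ 2 < C * m1 `^ l ->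
  m2 <= m1 + s * r - 2 * k * r ^+ 2.
Proof.
move=> sol r0 C0 hC m10 [h1 _] [_ [y0 [cy0 y0r uy0]]] [h4 _] em4 k0 ks hk.
have kr0 := mulr_gt0 k0 r0.
have [y0r'|y0r'] := leP (enorm (y0 - p)) r.
  have h2 := h1 y0 cy0 y0r'; rewrite uy0 in h2.
  have h3 := ler_wpM2r (ltW r0) ks; have h5 := mulr_gt0 kr0 r0.
  by clear -h2 h3 h5; rewrite expr2; lra.
have b0 : 0 <= s - 5 * k * r by lra.
have [|z [cz /andP[rz zr] zmax zjet]] :=
    @radial_max _ _ Om c l u p r (4 * r) _ k sol b0 (ltW k0) (or_intror r0).
  by exists y0; split => //; apply/andP; split; lra.
have : r <= enorm (y0 - p) <= 4 * r by apply/andP; split; lra.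
move=> /(zmax y0 cy0); rewrite uy0.
move: (y0r) (y0r') rz zr zjet.
have h1z := h1 z cz; have h4z := h4 z cz; have hCz := hC z.
move: (enorm (y0 - p)) (enorm (z - p)) h1z h4z hCz => D0 D h1z h4z hCz D02 D0r rD Dr zjet zmaxy.
(* The threshold is [m1] minus the profile at [r], and equally [m4] minus the profile at [4 * r]; a
   larger maximum would lie strictly inside the annulus. *)
have [uz|uz] := leP (u z - ((s - 5 * k * r) * D + k * D ^+ 2))
    (m1 - s * r + 4 * k * r ^+ 2).
  have g1 : 0 <= (2 * r - D0) * (s - 5 * k * r + k * (2 * r + D0)).
    apply: mulr_ge0; first by clear -D02; lra.
    by apply: addr_ge0 => //; apply: mulr_ge0; [exact: ltW|clear -r0 D0r; lra].
  by clear -g1 uz zmaxy; lra.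
exfalso.
have g1 : 0 <= (D - r) * (s - k * (4 * r - D)).
  apply: mulr_ge0; first by lra.
  have := ler_wpM2l (ltW k0) rD; by clear -ks kr0; lra.
have uzm : m1 < u z by clear -g1 uz; lra.
have [Dr1|rD1] := leP D r.
  by have := h1z Dr1; clear -uzm; lra.
have [D4|D4] := leP (4 * r) D.
  have D4e : D = 4 * r by apply: le_anti; rewrite D4 Dr.
  have := h4z Dr; move: uz; rewrite D4e em4; clear; lra.
have := zjet _ (lt_trans m10 uzm); rewrite rD1 D4 => /(_ isT) hz.
have e1 : C * m1 `^ l <= c (enorm z) * u z `^ l.
  apply: ler_pM; rewrite ?(ltW C0) ?powR_ge0 ?hCz //.
  have l3 := subsol_exponent_gt3 sol.
  apply: ge0_ler_powR; rewrite ?nnegrE ?(ltW m10) ?(ltW uzm) //; first by clear -l3; lra.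
  exact: ltW (lt_trans m10 uzm).
have e2 : (s - 5 * k * r + 2 * k * D) ^+ 2 <= (2 * s) ^+ 2.
  have g2 := ler_wpM2l (ltW k0) Dr.
  have g3 := mulr_ge0 (ltW k0) (le_trans (ltW r0) rD).
  rewrite ler_pXn2r ?nnegrE //; first by clear -g2 ks kr0; lra.
  - by clear -b0 g3; lra.
  - by clear -ks kr0; lra.
have k20 : 0 <= 2 * k by lra.
have e3 := ler_wpM2l k20 e2.
by clear -e1 e3 hz hk; lra.
Qed.

(** Annulus comparison with a small [k] gives [3 * m2 <= m4 + 2 * m1], which rearranges into the two
    slopes. *)
Lemma ball_max_slope_le Om c l u p (r C m1 m2 m4 : R) :
  monotone_subsolution Om c l u -> 0 < r -> 0 < C ->
  (forall y, enorm (y - p) <= 4 * r -> C <= c (enorm y)) -> 0 < m1 ->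
  ball_max Om u p r m1 -> ball_max Om u p (2 * r) m2 ->
  ball_max Om u p (4 * r) m4 -> (m2 - m1) / r <= (m4 - m2) / (2 * r).
Proof.
move=> sol r0 C0 hC m10 h1 h2 h4.
have hC2 y : enorm (y - p) <= 2 * r -> C <= c (enorm y).
  by move=> yr; apply: hC; lra.
have m12 := ball_max_lt sol r0 C0 hC2 m10 h1 h2.
have m24 : m2 <= m4 by apply: ball_max_le h2 h4; lra.
have rn0 : r != 0 by rewrite gt_eqF.
have [s [em4 s0]] : exists s, m4 = m1 + 3 * s * r /\ 0 < s.
  exists ((m4 - m1) / (3 * r)); split; first by field.
  by rewrite divr_gt0 ?mulr_gt0 //; clear -m12 m24; lra.
have d1 : 0 < s / (5 * r) by rewrite divr_gt0 // mulr_gt0.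
have d2 : 0 < C * m1 `^ l / (16 * s ^+ 2).
  by rewrite !(divr_gt0, mulr_gt0) ?exprn_gt0 ?powR_gt0.
have [k [k0 [k1 k2 _ _]]] := exists_le4 d1 d2 ltr01 ltr01.
rewrite ler_pdivlMr ?mulr_gt0 // in k1.
rewrite ler_pdivlMr ?mulr_gt0 ?exprn_gt0 // in k2.
have hk1 : 5 * k * r <= s by clear -k1; lra.
have hk2 : 8 * k * s ^+ 2 < C * m1 `^ l.
  by have := mulr_gt0 k0 (exprn_gt0 2 s0); clear -k2; lra.
have := annulus_comparison sol r0 C0 hC m10 h1 h2 h4 em4 k0 hk1 hk2.
have kr := mulr_gt0 k0 (exprn_gt0 2 r0) => hm.
rewrite ler_pdivrMr // mulrAC ler_pdivlMr ?mulr_gt0 //.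
have : 0 <= (m4 + 2 * m1 - 3 * m2) * r.
  by apply: mulr_ge0; [clear -hm kr em4; lra|exact: ltW].
by clear; lra.
Qed.

(** The value [8 / (2 * (1 - q)) ^+ 4], with [q] the doubling ratio: the Keller-Osserman bound for
    [C * rho ^+ 4 * u ^ (l - 3)] on a ball of radius [2 * rho]. *)
Definition KO_constant l : R := (2 * (1 - doubling_ratio l) ^+ 4)^-1.

Lemma KO_constant_gt0 l : 3 < l -> 0 < KO_constant l.
Proof.
move=> l3; have q1 := doubling_ratio_lt1 l3.
by rewrite invr_gt0 mulr_gt0 // exprn_gt0 // subr_gt0.
Qed.

(* [4 ^ - l] comes from [m >= s1 * r / 4] in the regular case, and [11 > 32 / 3]
   makes the comparison strict. *)
Definition growth_constant l : R := Num.min (4 `^ (- l) / 11) (4 * KO_constant l)^-1.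

Lemma growth_constant_gt0 l : 3 < l -> 0 < growth_constant l.
Proof.
move=> l3; rewrite lt_min divr_gt0 ?powR_gt0 //= invr_gt0 mulr_gt0 //.
exact: KO_constant_gt0.
Qed.

Definition drop_constant l : R :=
  Num.min ((1 - 2 `^ (- (l - 3))) / KO_constant l)
    (2 `^ (- (l - 3)) * ((l - 3) * growth_constant l / 2)).

Lemma drop_constant_gt0 l : 3 < l -> 0 < drop_constant l.
Proof.
move=> l3; have E0 : 0 < l - 3 by lra.
have h21 : 2 `^ (- (l - 3)) < 1 :> R.
  by rewrite /powR gt_eqF // expR_lt1 mulNr oppr_lt0 mulr_gt0 ?ln_gt0 ?ltr1n.
rewrite lt_min divr_gt0 ?subr_gt0 ?KO_constant_gt0 //=.
by rewrite !mulr_gt0 ?powR_gt0 ?growth_constant_gt0.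
Qed.

(* If one of the two consecutive slope ratios exceeds [2], the Keller-Osserman
   bound alone suffices; otherwise the comparison on the annulus [2r, 8r] with a
   quadratic profile forces the required growth of the slope. *)
Lemma dyadic_slope_drop Om c l u p (r C m0 m1 m2 m3 : R) :
  monotone_subsolution Om c l u -> 0 < r -> 0 < C ->
  (forall y, enorm (y - p) <= 8 * r -> C <= c (enorm y)) -> 0 < m0 ->
  ball_max Om u p r m0 -> ball_max Om u p (2 * r) m1 ->
  ball_max Om u p (4 * r) m2 -> ball_max Om u p (8 * r) m3 ->
  drop_constant l * (C * (2 * r) `^ (l + 1)) <=
    ((m1 - m0) / r) `^ (- (l - 3)) - ((m3 - m2) / (4 * r)) `^ (- (l - 3)).
Proof.
move=> sol r0 C0 hC m00 h0 h1 h2 h3.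
have l3 := subsol_exponent_gt3 sol; have q1 := doubling_ratio_lt1 l3.
have K0 := KO_constant_gt0 l3; have a0 := growth_constant_gt0 l3.
have hC2 y : enorm (y - p) <= 2 * r -> C <= c (enorm y).
  by move=> yr; apply: hC; clear -yr r0; lra.
have hC4 y : enorm (y - p) <= 4 * r -> C <= c (enorm y).
  by move=> yr; apply: hC; clear -yr r0; lra.
have m01 := ball_max_lt sol r0 C0 hC2 m00 h0 h1.
have s01 := ball_max_slope_le sol r0 C0 hC4 m00 h0 h1 h2.
have rn0 : r != 0 by rewrite gt_eqF.
have [rho [rho0 rhoE]] : exists rho, 0 < rho /\ rho = 2 * r.
  by exists (2 * r); rewrite mulr_gt0.
rewrite -rhoE in h1 *.
have e2 : 2 * rho = 4 * r by rewrite rhoE; ring.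
have e4 : 4 * rho = 8 * r by rewrite rhoE; ring.
have hC4' y : enorm (y - p) <= 4 * rho -> C <= c (enorm y) by rewrite e4; exact: hC.
have m10 := lt_trans m00 m01.
have s12 : (m2 - m1) / (2 * r) <= (m3 - m2) / (4 * r).
  rewrite -rhoE -e2; apply: (@ball_max_slope_le Om c l u p rho C) => //.
    by rewrite e2.
  by rewrite e4.
have s00 : 0 < (m1 - m0) / r by rewrite divr_gt0 // subr_gt0.
set s0 := (m1 - m0) / r in s00 s01 *; set s1 := (m2 - m1) / (2 * r) in s01 s12.
set s2 := (m3 - m2) / (4 * r) in s12 *.
have em1 : m1 = m0 + s0 * r by rewrite /s0; field.
have em2 : m2 = m1 + s1 * rho by rewrite /s1 rhoE; field.
have em3 : m3 = m2 + 2 * s2 * rho by rewrite /s2 rhoE; field.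
move: s0 s1 s2 s00 s01 s12 em1 em2 em3 => s0 s1 s2 s00 s01 s12 em1 em2 em3.
have s10 := lt_le_trans s00 s01.
have E0 : 0 < l - 3 by lra.
have wE : C * rho `^ (l + 1) * s1 `^ (l - 3) = C * rho ^+ 4 * (s1 * rho) `^ (l - 3).
  rewrite powRM ?(ltW s10) ?(ltW rho0) // -(@powR_mulrn _ rho 4) ?(ltW rho0) //.
  have -> : l + 1 = 4%:R + (l - 3) by ring.
  by rewrite (@powRD _ rho 4%:R (l - 3)) ?(gt_eqF rho0) ?implybT //; ring.
have w0 : 0 < C * rho `^ (l + 1) by rewrite mulr_gt0 // powR_gt0.
have aK : growth_constant l * KO_constant l <= 4^-1.
  have : growth_constant l <= (4 * KO_constant l)^-1 by rewrite ge_min lexx orbT.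
  by rewrite -[leRHS]div1r ler_pdivlMr ?mulr_gt0 //; clear; lra.
(* Keller-Osserman is used at a maximizer [z] for [m2]: the ball of radius [4 * r] around [z] stays
   within [8 * r] of [p], and [u z >= s1 * rho]. *)
have wK : C * rho `^ (l + 1) * s1 `^ (l - 3) <= KO_constant l.
  rewrite wE; case: h2 => _ [z [cz zr uz]].
  have m20 : 0 < u z by rewrite uz em2 addr_gt0 // mulr_gt0.
  have r40 : 0 < 4 * r by rewrite mulr_gt0.
  have hCz y : enorm (y - z) <= 4 * r -> C <= c (enorm y).
    by move=> yz; apply: hC; have := ler_enorm_distD z y p; clear -yz zr; lra.
  have := keller_osserman sol cz m20 r40 C0 hCz.
  have hs : (s1 * rho) `^ (l - 3) <= u z `^ (l - 3).
    apply: ge0_ler_powR; rewrite ?nnegrE ?(ltW E0) ?(ltW m20) //.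
      by rewrite mulr_ge0 // ltW.
    by rewrite uz em2; clear -m10; lra.
  have := ler_wpM2l (ltW (mulr_gt0 C0 (exprn_gt0 4 rho0))) hs => hs'.
  move=> hKO; apply: le_trans hs' _.
  have q0 : 0 < 2 * (1 - doubling_ratio l) ^+ 4.
    by rewrite mulr_gt0 // exprn_gt0 // subr_gt0.
  rewrite /KO_constant -div1r ler_pdivlMr //; move: hKO.
  have -> : C * u z `^ (l - 3) * ((1 - doubling_ratio l) * (4 * r)) ^+ 4 =
    8 * (C * rho ^+ 4 * u z `^ (l - 3) * (2 * (1 - doubling_ratio l) ^+ 4)).
    by rewrite rhoE; ring.
  by clear; lra.
apply: (@powRN_drop _ _ _ _ _ s0 s1 s2 E0 K0 a0) => //.
  by clear -aK; lra.
move=> s1s0 s2s1; set d := growth_constant l * _.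
have d0 : 0 < d by rewrite mulr_gt0 // mulr_gt0 // powR_gt0.
have d4 : d <= 4^-1 by apply: le_trans aK; rewrite ler_pM2l.
have dC : d <= 4 `^ (- l) / 11 * (C * rho ^+ 4 * (s1 * rho) `^ (l - 3)).
  by rewrite /d wE ler_wpM2r ?ge_min ?lexx // !mulr_ge0 ?powR_ge0 ?exprn_ge0 ?(ltW C0) ?(ltW rho0).
move: d d0 d4 dC => d d0 d4 dC.
(* [s] is the mean slope over [[rho, 4 * rho]], and [k] is tuned so that the resulting
   [s1 <= s - 2 * k * rho] reads [s1 * (1 + d) <= s2]. *)
pose s := (s1 + 2 * s2) / 3; pose k := d * s1 / (3 * rho).
have k0 : 0 < k by rewrite divr_gt0 ?mulr_gt0.
have rhon0 : rho != 0 by rewrite gt_eqF.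
have kE : k * rho = d * s1 / 3 by rewrite /k; field.
have ds : 0 <= (4^-1 - d) * s1 by rewrite mulr_ge0 ?subr_ge0 // ltW.
have hk1 : 5 * k * rho <= s.
  by rewrite -mulrA kE /s; clear -ds s12 s10; lra.
have em3' : m3 = m1 + 3 * s * rho by rewrite em3 em2 /s; field.
have h2' : ball_max Om u p (2 * rho) m2 by rewrite e2.
have h3' : ball_max Om u p (4 * rho) m3 by rewrite e4.
have hk2 : 8 * k * s ^+ 2 < C * m1 `^ l.
  have sr0 : 0 < s1 * rho / 4 by rewrite divr_gt0 ?mulr_gt0.
  apply: (@lt_le_trans _ _ (C * (s1 * rho / 4) `^ l)); last first.
    rewrite ler_pM2l //; apply: ge0_ler_powR; rewrite ?nnegrE ?(ltW m10) ?(ltW sr0) //.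
      by clear -l3; lra.
    have := ler_wpM2r (ltW r0) s1s0.
    by rewrite em1 rhoE; clear -m00; lra.
  have -> : (s1 * rho / 4) `^ l = 4 `^ (- l) * (s1 * rho) ^+ 3 * (s1 * rho) `^ (l - 3).
    rewrite powRM ?mulr_ge0 ?(ltW s10) ?(ltW rho0) // -powR_inv1 // -powRrM mulN1r.
    have -> : (s1 * rho) `^ l = (s1 * rho) ^+ 3 * (s1 * rho) `^ (l - 3).
      rewrite -powR_mulrn ?mulr_ge0 ?(ltW s10) ?(ltW rho0) //.
      rewrite -powRD ?(gt_eqF (mulr_gt0 s10 rho0)) ?implybT //.
      by congr (_ `^ _); ring.
    by ring.
  have s2' : s ^+ 2 <= (2 * s1) ^+ 2.
    have sge : 0 <= s by rewrite /s; clear -s12 s10; lra.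
    rewrite ler_pXn2r ?nnegrE // ?mulr_ge0 ?(ltW s10) //.
    by rewrite /s; clear -s2s1 s10; lra.
  have g1 := ler_wpM2l (ltW k0) s2'.
  have kd : k * s1 ^+ 2 * rho ^+ 4 = d * (s1 * rho) ^+ 3 / 3 by rewrite /k; field.
  have g2 := ler_wpM2r (exprn_ge0 3 (ltW (mulr_gt0 s10 rho0))) dC.
  have X0 : 0 < C * (4 `^ (- l) * (s1 * rho) ^+ 3 * (s1 * rho) `^ (l - 3)).
    by rewrite !mulr_gt0 ?powR_gt0 ?exprn_gt0 ?mulr_gt0.
  rewrite -(@ltr_pM2r _ (rho ^+ 4)) ?exprn_gt0 //.
  have g3 := ler_wpM2r (exprn_ge0 4 (ltW rho0)) g1.
  have X1 := mulr_gt0 X0 (exprn_gt0 4 rho0).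
  move: g2 g3 kd X1; clear.
  set Y := (s1 * rho) ^+ 3; set Z := _ `^ (l - 3); set F := 4 `^ (- l).
  set r4 := rho ^+ 4; set t := s ^+ 2; rewrite exprMn; set t1 := s1 ^+ 2.
  by move: Y Z F r4 t t1 => Y Z F r4 t t1; lra.
have := annulus_comparison sol rho0 C0 hC4' m10 h1 h2' h3' em3' k0 hk1 hk2.
rewrite em2 => hm.
have : s1 * rho <= (s - 2 * (k * rho)) * rho by clear -hm; rewrite expr2 in hm; lra.
by rewrite ler_pM2r // kE /s; clear; lra.
Qed.

End BallMaximum.

(** * Integral over a half-line controlled by a dyadic sum *)

Section DyadicIntegral.
Variables (R : realType) (g : R -> R) (l : R).
Hypothesis g_gt0 : forall r, 0 < g r.
Hypothesis g_noninc : forall r s, r <= s -> g s <= g r.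
Hypothesis l_ge0 : 0 <= l.
Local Notation mu := (@lebesgue_measure R).

Let f (r : R) : \bar R := (r `^ l * g r)%:E.

Let f_ge0 r : (0 <= f r)%E.
Proof. by rewrite lee_fin mulr_ge0 ?powR_ge0 // ltW. Qed.

Let measurable_f (D : set R) : measurable D -> measurable_fun D f.
Proof.
move=> mD; apply/measurable_EFinP; apply: measurable_funM.
  by apply: measurable_funTS; exact: measurable_powR.
by apply: nonincreasing_measurable.
Qed.

Lemma integral_itv_le (x y : R) : 0 < x -> x <= y ->
  (\int[mu]_(r in `[x, y[) f r <= (y `^ l * g x * (y - x))%:E)%E.
Proof.
move=> x0 xy.
apply: (@le_trans _ _ (\int[mu]_(r in `[x, y[) (cst (y `^ l * g x)%:E) r)%E).
  apply: ge0_le_integral => //; first exact: measurable_f.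
  move=> r /=; rewrite in_itv /= => /andP[xr ry]; rewrite lee_fin.
  have r0 := lt_le_trans x0 xr.
  apply: ler_pM; rewrite ?powR_ge0 ?(ltW (g_gt0 _)) ?g_noninc //.
  by apply: ge0_ler_powR; rewrite ?nnegrE ?(ltW r0) ?(ltW ry) ?(le_trans (ltW x0) xy).
rewrite integral_cst //= lebesgue_measure_itv /= lte_fin.
case: ltP => [_|yx]; first by rewrite -EFinD -EFinM.
by rewrite mule0 lee_fin mulr_ge0 ?subr_ge0 // mulr_ge0 ?powR_ge0 // ltW.
Qed.

(** On [[x, 2 * x[] the integral is at most [2 ^ l * g x * x ^ (l + 1)], [M] covers [[b, a[], and
    monotone convergence passes to the half-line. *)
Lemma integral_lty_of_dyadic_sum (a b B : R) : 0 < b -> b <= a ->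
  (forall N, \sum_(k < N) g (a * 2 ^+ k) * (a * 2 ^+ k) `^ (l + 1) <= B) ->
  (\int[mu]_(r in `[b, +oo[) f r < +oo)%E.
Proof.
move=> b0 ba hB; have a0 := lt_le_trans b0 ba.
pose S (N : nat) := `[b, a * 2 ^+ N[%classic.
have aN N : a <= a * 2 ^+ N by rewrite ler_peMr ?(ltW a0) // exprn_ege1 // ler1n.
pose M := a `^ l * g b * (a - b).
have bound N : (\int[mu]_(r in S N) f r <= (M + 2 `^ l *
    \sum_(k < N) g (a * 2 ^+ k) * (a * 2 ^+ k) `^ (l + 1))%:E)%E.
  elim: N => [|N IH].
    by rewrite /S expr0 mulr1 big_ord0 mulr0 addr0; exact: integral_itv_le.
  set x := a * 2 ^+ N; have x0 : 0 < x by rewrite mulr_gt0 ?exprn_gt0.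
  have SE : S N.+1 = S N `|` `[x, a * 2 ^+ N.+1[%classic.
    rewrite /S (@itv_bndbnd_setU _ _ _ (BLeft x)) // bnd_simp.
      exact: le_trans ba (aN N).
    by rewrite exprS mulrCA ler_peMl ?(ltW x0) // ler1n.
  have mS (i j : R) : measurable (`[i, j[%classic : set R) by exact: measurable_itv.
  have dS : [disjoint S N & `[x, a * 2 ^+ N.+1[%classic].
    rewrite disj_set2E; apply/eqP; rewrite -subset0 => r [/=].
    rewrite !in_itv /= => /andP[_ rx] /andP[xr _].
    by have := lt_le_trans rx xr; rewrite ltxx.
  have mSU := measurableU _ _ (mS b x) (mS x (a * 2 ^+ N.+1)).
  rewrite SE (ge0_integral_setU mu (mS _ _) (mS _ _) (measurable_f mSU)) //.
  have xx : x <= a * 2 ^+ N.+1.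
    by rewrite exprS mulrCA ler_peMl ?(ltW x0) // ler1n.
  apply: le_trans (leeD IH (integral_itv_le x0 xx)) _.
  rewrite -EFinD lee_fin big_ord_recr /= [in leRHS]mulrDr [in leRHS]addrA lerD2l -/x.
  rewrite le_eqVlt; apply/orP; left; apply/eqP.
  rewrite exprS mulrCA -/x powRM ?(ltW x0) //.
  rewrite (_ : x `^ (l + 1) = x `^ l * x); last first.
    by rewrite powRD ?(gt_eqF x0) ?implybT // powRr1 // ltW.
  by ring.
have SU : \bigcup_N S N = `[b, +oo[%classic.
  apply/seteqP; split => [r [N _]|r].
    by rewrite /S /= !in_itv /= => /andP[-> _].
  rewrite /= in_itv /=.
  rewrite andbT => br; exists (Num.bound (r / a)) => //; rewrite /S /= in_itv /= br /=.
  rewrite mulrC -ltr_pdivrMr //; apply: lt_le_trans (archi_boundP _) _.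
    by rewrite divr_ge0 // ltW // (lt_le_trans b0 br).
  by rewrite -natrX ler_nat ltnW // ltn_expl.
have ndS : nondecreasing_seq S.
  move=> i j ij; apply/subsetPset => r; rewrite /S /= !in_itv /= => /andP[-> ri] /=.
  by apply: lt_le_trans ri _; rewrite ler_pM2l // ler_eXn2l // ltr1n.
have cv : (\int[mu]_(r in S N) f r @[N --> \oo] --> \int[mu]_(r in `[b, +oo[) f r)%E.
  have mS N : measurable (S N) by rewrite /S; exact: measurable_itv.
  rewrite -SU; apply: ge0_nondecreasing_set_cvg_integral => //.
  by move=> N; exact: measurable_f.
apply: (@le_lt_trans _ _ (M + 2 `^ l * B)%:E); last exact: ltry.
rewrite -(cvg_lim _ cv) //; apply: lime_le; first by apply/cvg_ex; eexists; exact: cv.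
apply: nearW => N; apply: le_trans (bound N) _.
by rewrite lee_fin lerD2l ler_pM2l // powR_gt0.
Qed.

End DyadicIntegral.

(** * Telescoping over dyadic radii and the resulting contradiction *)

Lemma dyadic_sum_bound (R : realType) (n : nat) (Om : set 'rV[R]_n) (c : R -> R)
    (l : R) (u : 'rV[R]_n -> R) (p : 'rV[R]_n) (r0 : R) :
  monotone_subsolution Om c l u -> closure Om p -> 0 < u p -> 0 < r0 ->
  enorm p <= r0 ->
  exists B, forall N, \sum_(k < N)
    c (16 * r0 * 2 ^+ k) * (16 * r0 * 2 ^+ k) `^ (l + 1) <= B.
Proof.
move=> sol cp up r00 pr0.
pose r k := r0 * 2 ^+ k.
have r_gt0 k : 0 < r k by rewrite mulr_gt0 // exprn_gt0.
have rS k : r k.+1 = 2 * r k by rewrite /r exprS mulrCA.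
have r0r k : r0 <= r k by rewrite ler_peMr ?(ltW r00) // exprn_ege1 // ler1n.
have [m hm] := choice (fun k => ball_max_ex sol cp (ltW (r_gt0 k))).
have m_gt0 k : 0 < m k.
  case: (hm k) => + _ => /(_ p cp); rewrite subrr enorm0 (ltW (r_gt0 k)) => /(_ isT).
  exact: lt_le_trans up.
pose T k := ((m k.+1 - m k) / r k) `^ (- (l - 3)).
(* Since [|p| <= r0 <= r k], the ball of radius [8 * r k] around [p] lies within [9 * r k] of the
   origin, where [c] is at least [c (16 * r k)]. *)
have drop k : drop_constant l * (c (16 * r k) * (2 * r k) `^ (l + 1)) <= T k - T k.+2.
  have e4 : r k.+2 = 4 * r k by rewrite !rS; ring.
  have e8 : r k.+3 = 8 * r k by rewrite !rS; ring.
  rewrite /T e4; apply: (dyadic_slope_drop sol (r_gt0 k) (subsol_rhs_gt0 sol _) _ (m_gt0 k)).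
  - move=> y yp; apply: (subsol_rhs_noninc sol).
    have := ler_enormD (y - p) p; rewrite subrK.
    by have := r0r k; have := r_gt0 k; clear -yp pr0; lra.
  - exact: hm.
  - by rewrite -rS; exact: hm.
  - by rewrite -e4; exact: hm.
  - by rewrite -e8; exact: hm.
have T_ge0 k : 0 <= T k by exact: powR_ge0.
have l3 := subsol_exponent_gt3 sol; have dc0 := drop_constant_gt0 l3.
(* Each drop spans two indices, so two terms survive at either end. *)
have sumT N : \sum_(k < N) (T k - T k.+2) = T 0%N + T 1%N - T N - T N.+1.
  elim: N => [|N IH]; first by rewrite big_ord0; ring.
  by rewrite big_ord_recr /= IH; ring.
have sum_le N : drop_constant l * \sum_(k < N) c (16 * r k) * (2 * r k) `^ (l + 1)
    <= T 0%N + T 1%N.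
  rewrite mulr_sumr; apply: (@le_trans _ _ (\sum_(k < N) (T k - T k.+2))).
    by apply: ler_sum => k _; exact: drop.
  by rewrite sumT; have := T_ge0 N; have := T_ge0 N.+1; clear; lra.
exists (8 `^ (l + 1) * ((T 0%N + T 1%N) / drop_constant l)) => N.
have -> : \sum_(k < N) c (16 * r0 * 2 ^+ k) * (16 * r0 * 2 ^+ k) `^ (l + 1) =
    8 `^ (l + 1) * \sum_(k < N) c (16 * r k) * (2 * r k) `^ (l + 1).
  rewrite mulr_sumr; apply: eq_bigr => k _.
  have e1 : 16 * r0 * 2 ^+ k = 16 * r k by rewrite /r mulrA.
  have e2 : 16 * r k = 8 * (2 * r k) by move: (r k) => t; clear; lra.
  have p2 : 0 <= 2 * r k by rewrite mulr_ge0 // ltW.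
  by rewrite e1 [RHS]mulrCA -(powRM _ (ler0n _ 8) p2) -e2.
rewrite ler_pM2l ?powR_gt0 // ler_pdivlMr // mulrC; exact: sum_le.
Qed.

(** Away from the origin, monotonicity of [c] makes the truncated coefficient smaller. At the origin
    it equals [c 1]: [superjet2_origin] handles [u 0 > 0], and the right side vanishes if
    [u 0 = 0]. *)
Lemma solution_monotone_subsolution (R : realType) (n : nat) (Om : set 'rV[R]_n)
    (c : R -> R) (l : R) (u : 'rV[R]_n -> R) : (0 < n)%N -> open Om ->
  (forall r, 0 < r -> 0 < c r) ->
  (forall r s, 0 < r -> r <= s -> c s <= c r) -> 3 < l ->
  nonneg_solution Om c l u ->
  monotone_subsolution Om (fun r => c (Num.max r 1)) l u.
Proof.
move=> n0 oO c0 cn l3 [u0 uu ub uj].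
have max_gt0 r : 0 < Num.max r 1 :> R by rewrite lt_max ltr01 orbT.
split => //.
- move=> x Ox v A jA; have [x0|x0] := eqVneq x 0.
    rewrite x0 in Ox jA *; rewrite enorm0 max_r //.
    have := u0 0 (subset_closure Ox); rewrite le_eqVlt => /orP[/eqP u00|u0p].
      have := uj 0 Ox v A jA; rewrite -u00 powR0 ?mulr0 //.
      by rewrite gt_eqF //; clear -l3; lra.
    apply: (superjet2_origin n0 oO Ox uu u0p _ uj) jA; last 2 first.
    - exact: c0.
    - by move=> r r0 r1; exact: cn.
    - by clear -l3; lra.
  apply: le_trans (uj x Ox v A jA); apply: ler_wpM2r; first exact: powR_ge0.
  by apply: cn; [exact: enorm_gt0|rewrite le_max lexx].
- by move=> r; exact: c0.
- move=> r s rs; apply: cn => //.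
  by rewrite ge_max !le_max rs lexx orbT.
Qed.

Theorem corollary1 (R : realType) (n : nat) (Om : set 'rV[R]_n)
  (rstar : R) (c : R -> R) (lambda : R) (u : 'rV[R]_n -> R) :
  (2 <= n)%N ->
  open Om -> connected Om -> Om !=set0 ->
  (forall M : R, exists x, Om x /\ M < enorm x) ->
  0 < rstar ->
  (forall r : R, rstar < r -> exists x, Om x /\ enorm x = r) ->
  (forall r : R, 0 < r -> 0 < c r) ->
  (forall r s : R, 0 < r -> r <= s -> c s <= c r) ->
  3 < lambda ->
  (\int[lebesgue_measure]_(r in `[rstar, +oo[) (r `^ lambda * c r)%:E = +oo)%E ->
  nonneg_solution Om c lambda u ->
  forall x, closure Om x -> u x = 0.
Proof.
move=> n2 oO _ _ _ rs0 _ c0 cn l3 int_c hu x cx.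
have sol := solution_monotone_subsolution (ltnW n2) oO c0 cn l3 hu.
apply/eqP; rewrite eq_le (subsol_ge0 sol cx) andbT leNgt; apply/negP => ux.
have xn := enorm_ge0 x.
(* Beyond this radius both truncations, at [1] and at [rstar], agree with [c]. *)
pose r0 := enorm x + 1 + rstar.
have [r00 xr0 r01 r0s] : [/\ 0 < r0, enorm x <= r0, 1 <= r0 & rstar <= r0].
  by rewrite /r0; split; lra.
have [B hB] := dyadic_sum_bound sol cx ux r00 xr0.
(* [g] equals [c] on the range of integration and is positive and non-increasing on all of [R], as
   the integral test requires. *)
pose g r := c (Num.max r rstar).
have max_gt0 r : 0 < Num.max r rstar by rewrite lt_max rs0 orbT.
have : (\int[lebesgue_measure]_(r in `[rstar, +oo[) (r `^ lambda * g r)%:E < +oo)%E.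
  apply: (@integral_lty_of_dyadic_sum _ g lambda _ _ _ (16 * r0) rstar B) => //.
  - by move=> r; exact: c0.
  - by move=> r s rs; apply: cn => //; rewrite ge_max !le_max rs lexx orbT.
  - by lra.
  - by lra.
  move=> N; apply: le_trans (hB N); apply: ler_sum => k _.
  have r2 : r0 <= 16 * r0 * 2 ^+ k.
    have := @exprn_ege1 R k 2 (ler1n _ 2); move: (2 ^+ k) => t t1.
    by have := ler_wpM2l (ltW r00) t1; clear -r00; lra.
  by rewrite /g !max_l //; lra.
have <- : (\int[lebesgue_measure]_(r in `[rstar, +oo[) (r `^ lambda * c r)%:E =
    \int[lebesgue_measure]_(r in `[rstar, +oo[) (r `^ lambda * g r)%:E)%E.
  apply: eq_integral => r; rewrite inE /= in_itv /= andbT => rr.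
  by rewrite /g max_l.
by rewrite int_c ltxx.
Qed.
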